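(* Let $V\subset L^2_0(\mu)$ be a linear subspace, let $$\gamma_V:=\inf_{f\in \operatorname{Dom}(L)\cap V\setminus\{0\}}\frac{\|Lf\|}{\|f\|},\qquad U:=L(V\cap\operatorname{Dom}(L))\subset L^2_0(\mu),$$ and assume $\gamma_V>0$. Then for every $t>0$: (i) $\displaystyle \Delta_t^U\le \frac{2}{\sqrt{t\,\gamma_V}}$; (ii) $\displaystyle \sup_{s\in[t,2t]}\Delta_s^{U+V}\ge \frac{1}{\frac32\, t\,\gamma_V+3}$.
   Context: Let $(X_t)_{t\ge0}$ be a time-homogeneous Markov process on a measurable space $S$, with jointly measurable sample paths and an invariant probability measure $\mu$. $L^2(\mu)$ is the space of complex-valued square-integrable functions with $\langle f,g\rangle=\int \bar f g\,d\mu$ and norm $\|\cdot\|$; $L^2_0(\mu)=\{g\in L^2(\mu):\int g\,d\mu=0\}$. The semigroup $P_tg(x)=\mathbb E_x[g(X_t)]$ is assumed strongly continuous on $L^2(\mu)$; its generator is $Lg=\lim_{t\downarrow0}(P_tg-g)/t$ with $\operatorname{Dom}(L)$ the set of $g\in L^2(\mu)$ for which the limit exists in $L^2(\mu)$. $\mathbb E_\mu$ denotes expectation for the process started from $X_0\sim\mu$. Write $\mu g=\int g\,d\mu$, $\mu_tg=\frac1t\int_0^tg(X_s)\,ds$, and $\operatorname{Var}_\mu(\mu_tg)=\mathbb E_\mu|\mu_tg-\mu g|^2$. For a linear subspace $W\subset L^2_0(\mu)$ set $$\Delta_t^W:=\sup_{g\in W,\ \|g\|=1}\sqrt{\operatorname{Var}_\mu(\mu_tg)}.$$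 Usual conventions in degenerate cases: $\inf\emptyset=+\infty$, $\sup\emptyset=0$, $1/\infty=0$. *)

(* Defs.v *)
From HB Require Import structures.
From mathcomp Require Import all_boot all_order all_algebra.
From mathcomp Require Import complex.
From mathcomp Require Import all_classical all_reals all_analysis.

Set Implicit Arguments.
Unset Strict Implicit.
Unset Printing Implicit Defensive.

Import Order.TTheory GRing.Theory Num.Theory.
Import numFieldTopology.Exports numFieldNormedType.Exports.
Import ComplexField.Normc.

Local Open Scope classical_set_scope.
Local Open Scope complex_scope.
Local Open Scope ring_scope.

Section complex_functions.
Context d (T : measurableType d) (R : realType).
Implicit Types (m : {measure set T -> \bar R}) (f : T -> R[i]).

(* Borel measurability for the topology of the complex plane *)
Definition cmeasurable f : Prop :=
  measurable_fun setT (fun x => complex.Re (f x)) /\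
  measurable_fun setT (fun x => complex.Im (f x)).

Definition cintegral m (D : set T) f : R[i] :=
  (\int[m]_(x in D) complex.Re (f x)) +i* (\int[m]_(x in D) complex.Im (f x)).

Definition L2norm m f : \bar R := 'N[m]_2%:E[EFin \o (fun x => normc (f x))]%E.

(* Elements of L^2 are represented by functions. Sets of such functions stand
   for sets of classes modulo equality almost everywhere, see
   [linear_subspace]. *)
Definition L2 m : set (T -> R[i]) :=
  [set f | cmeasurable f /\ (L2norm m f < +oo)%E].

Definition L20 m : set (T -> R[i]) :=
  [set f | L2 m f /\ cintegral m setT f = 0].

(* Linear subspaces of L^2(m): the saturation condition [lsub_ae] makes [W] the
   inverse image of a subspace of the quotient by almost everywhere equality. *)
Record linear_subspace m (W : set (T -> R[i])) : Prop := LinearSubspace {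
  lsub_L2 : W `<=` L2 m ;
  lsub_0 : W (fun=> 0) ;
  lsub_lin : forall (c : R[i]) f g, W f -> W g -> W (fun x => c * f x + g x) ;
  lsub_ae : forall f g, W f -> cmeasurable g ->
    {ae m, forall x, f x = g x} -> W g }.

Definition sumset (U V : set (T -> R[i])) : set (T -> R[i]) :=
  [set (fun x => u x + v x) | u in U & v in V].

End complex_functions.

Section start_law.
Context d d' (S : measurableType d) (Omega : measurableType d') (R : realType).
Variables (mu : probability S R) (Pr : R.-pker S ~> Omega).

(* the law P_mu of the process started from X_0 ~ mu, when [Pr x] is the law
   P_x of the process started from x *)
Definition start_law (A : set Omega) : \bar R := (\int[mu]_x Pr x A)%E.

Let start_law0 : start_law set0 = 0%E.
Proof. by apply: integral0_eq => x _; rewrite measure0. Qed.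

Let start_law_ge0 A : (0 <= start_law A)%E.
Proof. by apply: integral_ge0 => x _; exact: measure_ge0. Qed.

Let start_law_sigma_additive : semi_sigma_additive start_law.
Proof.
move=> F mF tF mUF; rewrite [X in _ --> X](_ : _ =
    \int[mu]_x (\sum_(0 <= n <oo) Pr x (F n)))%E; last first.
  apply: eq_integral => x _.
  by apply/esym/cvg_lim => //; exact: measure_semi_sigma_additive.
apply/cvg_closeP; split.
  by apply: is_cvg_nneseries => n _ _; exact: start_law_ge0.
rewrite closeE// integral_nneseries// => n.
exact: measurable_kernel.
Qed.

HB.instance Definition _ := isMeasure.Build _ _ _ start_law
  start_law0 start_law_ge0 start_law_sigma_additive.

Let start_law_setT : start_law setT = 1%E.
Proof.
rewrite /start_law.
under eq_integral do rewrite prob_kernel.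
by rewrite integral_cst//= mul1e probability_setT.
Qed.

HB.instance Definition _ :=
  Measure_isProbability.Build _ _ _ start_law start_law_setT.

End start_law.

Section markov_process.
Context d d' (S : measurableType d) (Omega : measurableType d') (R : realType).
Implicit Types (mu : probability S R) (Pr : R.-pker S ~> Omega)
  (X : R -> Omega -> S).

Definition natural_filtration X (s : R) : set (set Omega) :=
  <<s [set X u @^-1` B | u in `[0, s] & B in measurable] >>.

(* Time-homogeneous Markov process with state space [S], jointly measurable
   paths and laws [Pr x]; the values [X t] for t < 0 are irrelevant *)
Record markov_process Pr X : Prop := MarkovProcess {
  mp_measurable :
    measurable_fun [set p : measurableTypeR R * Omega | 0 <= p.1]
      (fun p => X p.1 p.2) ;
  mp_start : forall x B, measurable B -> Pr x (X 0 @^-1` B) = \d_x B ;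
  mp_markov : forall x (s t : R) A B, 0 <= s -> 0 <= t ->
    natural_filtration X s A -> measurable B ->
    Pr x (A `&` X (s + t) @^-1` B) =
      (\int[Pr x]_(w in A) Pr (X s w) (X t @^-1` B))%E }.

Definition invariant_measure mu Pr X : Prop :=
  forall (t : R) B, 0 <= t -> measurable B ->
    (\int[mu]_x Pr x (X t @^-1` B))%E = mu B.

Definition semigroup Pr X (t : R) (g : S -> R[i]) : S -> R[i] :=
  fun x => cintegral (Pr x) setT (fun w => g (X t w)).

Definition strongly_continuous mu Pr X : Prop :=
  forall g, L2 mu g ->
    L2norm mu (fun x => semigroup Pr X t g x - g x) @[t --> 0^'+] --> 0%E.

(* The graph of the generator L: [generator mu Pr X f h] means that f is in
   Dom(L) and that h is a version of Lf. *)
Definition generator mu Pr X (f h : S -> R[i]) : Prop :=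
  [/\ L2 mu f, L2 mu h &
    L2norm mu (fun x => (t^-1)%:C * (semigroup Pr X t f x - f x) - h x)
      @[t --> 0^'+] --> 0%E].

(* L(V `&` Dom(L)) *)
Definition generator_image mu Pr X (V : set (S -> R[i])) : set (S -> R[i]) :=
  [set h | exists2 f, V f & generator mu Pr X f h].

Definition gamma mu Pr X (V : set (S -> R[i])) : \bar R :=
  ereal_inf [set r | exists f h, [/\ V f, generator mu Pr X f h,
    ~ {ae mu, forall x, f x = 0} & r = (L2norm mu h / L2norm mu f)%E]].

(* mu_t g, a random variable *)
Definition time_average X (t : R) (g : S -> R[i]) (w : Omega) : R[i] :=
  (t^-1)%:C * cintegral lebesgue_measure `[0, t] (fun s => g (X s w)).

Definition time_average_var mu Pr X (t : R) (g : S -> R[i]) : \bar R :=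
  (\int[start_law mu Pr]_w
     (normc (time_average X t g w - cintegral mu setT g) ^+ 2)%:E)%E.

(* The element 0 is added to implement the convention sup set0 = 0: the other
   elements are nonnegative. *)
Definition Delta mu Pr X (W : set (S -> R[i])) (t : R) : \bar R :=
  ereal_sup (0%E |` [set sqrte (time_average_var mu Pr X t g) |
                      g in [set g | W g /\ L2norm mu g = 1%E]]).

End markov_process.

(* Main.v *)
Require Import Defs.
From HB Require Import structures.
From mathcomp Require Import all_boot all_order all_algebra.
From mathcomp Require Import complex ring lra.
From mathcomp Require Import all_classical all_reals all_analysis.
From mathcomp Require Import measurable_realfun.

(** Let P be the law of the stationary process and
    C(u, f; r) = E_P[u(X_0) f(X_r)]. Stationarity and the Markov property give
    E_P[u(X_r) f(X_(r+s))] = C(u, f; s) and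
    |C(u, f; r+s) - C(u, k; r)| <= |u| |P_s f - k|. Taking k = f and
    k = f + s Lf, the second bound shows that, when h = Lf, the correlation
    C(u, f; .) is continuously differentiable with derivative C(u, h; .): this
    is Dynkin's formula
    [dynkin], C(u, f; t) - C(u, f; 0) = int_0^t C(u, h; s) ds, in a weak form
    that involves only integrals of real functions.

    Upper bound. By Fubini, the second moment of int_0^t h(X_s) ds is the
    integral over r of int_0^t C(h, h; |s - r|) ds. By Dynkin's formula on
    both sides of r the inner integral is a sum of four values of +-C(h, f; .),
    each at most |h| |f| by Cauchy-Schwarz; hence
    Var(mu_t h) <= (4 / t) |h| |f| ([time_integral_variance]), and
    |f| <= |h| / gamma when f is in V.

    Lower bound. Let f in V, h = Lf and D bound Delta_s on [t, 2t]. Writing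
    c(s) = C(f, f; s) one has |f|^2 - c(s) = - E_P[f(X_0) int_0^s h(X_r) dr],
    which Cauchy-Schwarz bounds by |f| s D |h|, and
    int_0^s c = E_P[f(X_0) int_0^s f(X_r) dr], which is at most s D |f|^2.
    Integrating the first bound over [t, 2t] and using the second one at t and
    2t gives t |f|^2 <= (3/2) t^2 D |f| |h| + 3 t D |f|^2
    ([relaxation_lower_bound]). Dividing by t |f|^2 and letting |h| / |f|
    approach gamma gives the claim.

    The semigroup is real, so that real and imaginary parts of a
    relation h = Lf satisfy it separately: the analysis is done for real
    functions and the parts are recombined by a Cauchy-Schwarz inequality for
    pairs. *)

Set Implicit Arguments.
Unset Strict Implicit.
Unset Printing Implicit Defensive.

Import Order.TTheory GRing.Theory Num.Theory.
Import numFieldTopology.Exports numFieldNormedType.Exports.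
Import ComplexField.Normc.

Local Open Scope classical_set_scope.
Local Open Scope complex_scope.
Local Open Scope ring_scope.

(** * Square-integrable real functions *)

Section square_integrable.
Context d (T : measurableType d) (R : realType).
Variable m : {measure set T -> \bar R}.
Implicit Types f g h : T -> R.

Definition sqint f : Prop :=
  measurable_fun setT f /\ m.-integrable setT (EFin \o (fun x => f x ^+ 2)).

Definition l2norm f : R := Num.sqrt (\int[m]_x (f x ^+ 2)).

Lemma sqint_le f g : measurable_fun setT f -> sqint g ->
  (forall x, f x ^+ 2 <= g x ^+ 2) -> sqint f.
Proof.
move=> mf [mg ig] fg; split=> //.
apply: le_integrable ig => //=.
  by apply/measurable_EFinP; apply: measurable_funX.
by move=> x _; rewrite lee_fin !ger0_norm ?sqr_ge0.
Qed.

Lemma sqintM f g : sqint f -> sqint g ->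
  m.-integrable setT (EFin \o (fun x => f x * g x)).
Proof.
move=> [mf if2] [mg ig2].
apply: le_integrable (integrableD measurableT if2 ig2) => //=.
  by apply/measurable_EFinP; apply: measurable_funM.
move=> x _; rewrite lee_fin (@ger0_norm _ (_ + _)) ?addr_ge0 ?sqr_ge0//.
by rewrite ler_norml; apply/andP; split; nra.
Qed.

Lemma sqintZ (a : R) f : sqint f -> sqint (fun x => a * f x).
Proof.
move=> [mf if2]; split; first exact: measurable_funM.
have := integrableZl measurableT (a ^+ 2) if2.
apply: eq_integrable => // x _ /=.
by rewrite exprMn EFinM.
Qed.

Lemma sqintD f g : sqint f -> sqint g -> sqint (fun x => f x + g x).
Proof.
move=> sf sg; have fg := sqintM sf sg.
move: sf sg => [mf if2] [mg ig2]; split; first exact: measurable_funD.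
have := integrableD measurableT (integrableD measurableT if2 ig2)
  (integrableD measurableT fg fg).
apply: eq_integrable => // x _ /=.
by rewrite -!EFinD; congr EFin; ring.
Qed.

Lemma integrable_scale f (a : R) : m.-integrable setT (EFin \o f) ->
  m.-integrable setT (EFin \o (fun x => a * f x)).
Proof. by move/(integrableZl measurableT a); apply: eq_integrable. Qed.

Lemma integrable_add f g :
  m.-integrable setT (EFin \o f) -> m.-integrable setT (EFin \o g) ->
  m.-integrable setT (EFin \o (fun x => f x + g x)).
Proof. by move=> fi /(integrableD measurableT fi); apply: eq_integrable. Qed.

(** The quadratic form of Cauchy-Schwarz. It is additive in the pair (f, g), so
    that summing it over two pairs gives the inequality for vector-valued
    functions. *)
Lemma young_Rintegral f g (l : R) : sqint f -> sqint g -> 0 < l ->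
  2 * \int[m]_x (f x * g x) <=
    l * \int[m]_x (f x ^+ 2) + l^-1 * \int[m]_x (g x ^+ 2).
Proof.
move=> sf sg l0; have ifg := sqintM sf sg.
move: sf sg => [mf if2] [mg ig2].
have if2l := integrable_scale l if2; have ig2l := integrable_scale l^-1 ig2.
rewrite -!RintegralZl// -RintegralD//.
apply: le_Rintegral => //; [exact: integrable_scale|exact: integrable_add|].
move=> x _.
rewrite -subr_ge0 (_ : _ - _ = l^-1 * (l * f x - g x) ^+ 2).
  by rewrite mulr_ge0 ?sqr_ge0// invr_ge0 ltW.
by field; rewrite gt_eqF.
Qed.

End square_integrable.

(** Optimizing over l; when a or b vanishes the optimal l is infinite or 0, and
    an explicit l refutes x > 0 instead. *)
Lemma young_sqrt (R : realType) (x a b : R) : 0 <= a -> 0 <= b ->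
  (forall l, 0 < l -> 2 * x <= l * a + l^-1 * b) ->
  x <= Num.sqrt a * Num.sqrt b.
Proof.
move=> a0 b0 H.
have [aE|an0] := eqVneq a 0; first subst a.
  rewrite sqrtr0 mul0r leNgt; apply/negP => x0.
  (* the right-hand side is x * b / (b + 1) for this l *)
  have := H ((b + 1) / x) (divr_gt0 (ltr_wpDl b0 ltr01) x0).
  rewrite mulr0 add0r invf_div mulrAC ler_pdivlMr ?ltr_wpDl//.
  nra.
have [bE|bn0] := eqVneq b 0; first subst b.
  rewrite sqrtr0 mulr0 leNgt; apply/negP => x0.
  have a0' : 0 < a by rewrite lt_neqAle eq_sym an0.
  have := H (x / a) (divr_gt0 x0 a0').
  by rewrite mulr0 addr0 mulfVK//; lra.
have sa : 0 < Num.sqrt a by rewrite sqrtr_gt0 lt_neqAle eq_sym an0.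
have sb : 0 < Num.sqrt b by rewrite sqrtr_gt0 lt_neqAle eq_sym bn0.
have := H (Num.sqrt b / Num.sqrt a) (divr_gt0 sb sa).
rewrite -{2}(sqr_sqrtr a0) -{3}(sqr_sqrtr b0) (_ : _ + _ =
  2 * (Num.sqrt a * Num.sqrt b)); first by rewrite ler_pM2l.
by field; rewrite !gt_eqF.
Qed.

Section cauchy_schwarz.
Context d (T : measurableType d) (R : realType).
Variable m : {measure set T -> \bar R}.
Implicit Types f g h : T -> R.

(** Cauchy-Schwarz for pairs of functions: the form needed for the two parts of
    complex functions. *)
Lemma cauchy_schwarz2 f1 g1 f2 g2 :
  sqint m f1 -> sqint m g1 -> sqint m f2 -> sqint m g2 ->
  `|\int[m]_x (f1 x * g1 x) + \int[m]_x (f2 x * g2 x)| <=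
  Num.sqrt (\int[m]_x (f1 x ^+ 2) + \int[m]_x (f2 x ^+ 2)) *
  Num.sqrt (\int[m]_x (g1 x ^+ 2) + \int[m]_x (g2 x ^+ 2)).
Proof.
move=> f1s g1s f2s g2s.
have sq0 h : 0 <= \int[m]_x (h x ^+ 2).
  by rewrite Rintegral_ge0// => x _; rewrite sqr_ge0.
have NM f g : sqint m f -> sqint m g ->
    \int[m]_x ((-1 * f x) * g x) = - \int[m]_x (f x * g x).
  move=> fs gs; under eq_Rintegral do rewrite -mulrA.
  by rewrite RintegralZl ?mulN1r//; exact: sqintM.
have N2 f : \int[m]_x ((-1 * f x) ^+ 2) = \int[m]_x (f x ^+ 2).
  by apply: eq_Rintegral => x _; rewrite mulN1r sqrrN.
rewrite ler_norml lerNl; apply/andP.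
split; apply: young_sqrt; rewrite ?addr_ge0// => l l0.
- have := young_Rintegral (sqintZ (-1) f1s) g1s l0.
  have := young_Rintegral (sqintZ (-1) f2s) g2s l0.
  by rewrite !N2 !NM//; lra.
- have := young_Rintegral f1s g1s l0; have := young_Rintegral f2s g2s l0; lra.
Qed.

Lemma cauchy_schwarz f g : sqint m f -> sqint m g ->
  `|\int[m]_x (f x * g x)| <= l2norm m f * l2norm m g.
Proof.
move=> fs gs.
have s0 : sqint m (cst 0).
  by split=> //; apply: eq_integrable (integrable0 _ _) => // x _; rewrite /= expr0n.
have R0 : \int[m]_x (0 : R) = 0 by rewrite /Rintegral integral0.
have := cauchy_schwarz2 fs gs s0 s0.
have -> : \int[m]_x (cst 0 x * cst 0 x) = 0 :> R.
  by rewrite -[RHS]R0; apply: eq_Rintegral => x _; rewrite mulr0.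
by rewrite !addr0.
Qed.

Lemma l2norm_normr f : l2norm m (fun x => `|f x|) = l2norm m f.
Proof.
by congr Num.sqrt; apply: eq_Rintegral => x _; rewrite real_normK// num_real.
Qed.

Lemma sqint_normr f : sqint m f -> sqint m (fun x => `|f x|).
Proof.
move=> fs; apply: (sqint_le _ fs); first exact: measurableT_comp fs.1.
by move=> x; rewrite real_normK// num_real.
Qed.

Lemma ge0_cauchy_schwarz f g : sqint m f -> sqint m g ->
  (\int[m]_x `|f x * g x|%:E <= (l2norm m f * l2norm m g)%:E)%E.
Proof.
move=> /sqint_normr fs /sqint_normr gs; have fgi := sqintM fs gs.
under eq_integral do rewrite normrM.
rewrite -(fineK (integrable_fin_num measurableT fgi)) lee_fin.
rewrite -(l2norm_normr f) -(l2norm_normr g).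
exact: le_trans (ler_norm _) (cauchy_schwarz fs gs).
Qed.

End cauchy_schwarz.

Section probability_sqint.
Context d (T : measurableType d) (R : realType) (P : probability T R).

Lemma sqint_cst (a : R) : sqint P (cst a).
Proof. by split => //; exact: (finite_measure_integrable_cst P (a ^+ 2)). Qed.

Lemma sqint_integrable (f : T -> R) : sqint P f ->
  P.-integrable setT (EFin \o f).
Proof.
move=> sf; apply: eq_integrable (sqintM sf (sqint_cst 1)) => // x _ /=.
by rewrite mulr1.
Qed.

End probability_sqint.

(** * Mixtures of a probability kernel *)

Section bind.
Context d d' (T : measurableType d) (T' : measurableType d') (R : realType).
Variables (m : probability T R) (k : R.-pker T ~> T').

(** A kernel seen as parameterized by the unit type, the shape expected by
    [integral_kcomp]. *)
Definition kernel_snd (p : unit * T) : {measure set T' -> \bar R} := k p.2.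

Let measurable_kernel_snd U : measurable U ->
  measurable_fun setT (kernel_snd ^~ U).
Proof.
move=> mU; apply: (measurableT_comp (measurable_kernel k U mU)).
exact: measurable_snd.
Qed.

HB.instance Definition _ :=
  isKernel.Build _ _ _ _ R kernel_snd measurable_kernel_snd.

Let kernel_snd_prob p : kernel_snd p setT = 1%E.
Proof. exact: prob_kernel. Qed.

HB.instance Definition _ :=
  Kernel_isProbability.Build _ _ _ _ R kernel_snd kernel_snd_prob.

Lemma ge0_integral_start_law (f : T' -> \bar R) :
  (forall y, 0 <= f y)%E -> measurable_fun setT f ->
  (\int[start_law m k]_y f y = \int[m]_x \int[k x]_y f y)%E.
Proof.
move=> f0 mf.
pose l : R.-pker unit ~> T :=
  kprobability (measurable_cst (m : pprobability T R)).
exact: (integral_kcomp l kernel_snd tt f0 mf).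
Qed.

Let ge0_measurable_bind (g : T' -> \bar R) :
  (forall y, 0 <= g y)%E -> measurable_fun setT g ->
  measurable_fun setT (fun x => \int[k x]_y g y)%E.
Proof.
by move=> g0 mg; apply: measurable_fun_integral_kernel => //; exact: measurable_kernel.
Qed.

Let ge0_integrable_bind (g : T' -> \bar R) :
  (forall y, 0 <= g y)%E -> (start_law m k).-integrable setT g ->
  m.-integrable setT (fun x => \int[k x]_y g y)%E.
Proof.
move=> g0 /integrableP[mg goo]; apply/integrableP; split.
  exact: ge0_measurable_bind.
apply: le_lt_trans goo; under [leRHS]eq_integral do rewrite gee0_abs//.
rewrite ge0_integral_start_law// le_eqVlt; apply/orP; left; apply/eqP.
by apply: eq_integral => x _; rewrite gee0_abs// integral_ge0.
Qed.

Lemma measurable_Rintegral_kernel (f : T' -> R) : measurable_fun setT f ->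
  measurable_fun setT (fun x => \int[k x]_y f y).
Proof.
move=> /measurable_EFinP mf.
apply: (measurableT_comp (f := fine) (g := fun x => \int[k x]_y (f y)%:E)%E) => //.
under eq_fun do rewrite integralE.
apply: emeasurable_funB; apply: ge0_measurable_bind => //.
- exact: measurable_funepos.
- exact: measurable_funeneg.
Qed.

Lemma ae_integrable_start_law (f : T' -> R) :
  (start_law m k).-integrable setT (EFin \o f) ->
  {ae m, forall x, (k x).-integrable setT (EFin \o f)}.
Proof.
move=> fi; have /integrableP[mf _] := fi.
have := ge0_integrable_bind (g := abse \o (EFin \o f)) _ (integrable_abse fi).
move=> /(_ (fun=> abse_ge0 _)) /(integrable_ae measurableT).
apply: filterS => x /(_ I) fin; apply/integrableP; split=> //.
by rewrite -ge0_fin_numE// integral_ge0.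
Qed.

(** The signed version of [ge0_integral_start_law]. The inner integral has real
    values and is meaningful for almost every x only, which suffices. *)
Lemma integral_start_law (f : T' -> R) :
  (start_law m k).-integrable setT (EFin \o f) ->
  \int[start_law m k]_y f y = \int[m]_x \int[k x]_y f y.
Proof.
move=> fi; have /integrableP[mf foo] := fi.
have mp := measurable_funepos mf; have mn := measurable_funeneg mf.
have ip := integrable_funepos measurableT fi.
have iN := integrable_funeneg measurableT fi.
rewrite /Rintegral integralE !ge0_integral_start_law//; congr fine.
rewrite -integralB//; [|exact: ge0_integrable_bind..].
apply: ae_eq_integral => //.
- by apply: emeasurable_funB; exact: ge0_measurable_bind.
- by apply/measurable_EFinP; apply: measurable_Rintegral_kernel; exact/measurable_EFinP.
apply: filterS (ae_integrable_start_law fi) => x fix_ _.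
by rewrite -integralE fineK// integrable_fin_num.
Qed.

End bind.

Section image_measure.
Context d1 d2 (T1 : measurableType d1) (T2 : measurableType d2) (R : realType).
Variables (m : {measure set T1 -> \bar R}) (phi : T1 -> T2).
Hypothesis mphi : measurable_fun setT phi.

(** The measurability proof is an argument because it cannot be inferred from
    [pushforward m phi]. *)
Definition image_measure : {measure set T2 -> \bar R}.
Proof. refine (pushforward m phi); exact: mphi. Defined.

Lemma image_measureE A : image_measure A = m (phi @^-1` A).
Proof. by []. Qed.

Lemma ge0_integral_image (f : T2 -> \bar R) :
  (forall y, 0 <= f y)%E -> measurable_fun setT f ->
  (\int[image_measure]_y f y = \int[m]_x f (phi x))%E.
Proof. by move=> f0 mf; rewrite ge0_integral_pushforward. Qed.

Lemma integral_image (f : T2 -> \bar R) : measurable_fun setT f ->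
  (\int[image_measure]_y f y = \int[m]_x f (phi x))%E.
Proof.
move=> mf; rewrite integralE [RHS]integralE.
congr (_ - _)%E; rewrite ge0_integral_image.
- by apply: eq_integral => x _; rewrite !funeposE.
- by move=> y; exact: funepos_ge0.
- exact: measurable_funepos.
- by apply: eq_integral => x _; rewrite !funenegE.
- by move=> y; exact: funeneg_ge0.
- exact: measurable_funeneg.
Qed.

Lemma Rintegral_image (f : T2 -> R) : measurable_fun setT f ->
  \int[image_measure]_y f y = \int[m]_x f (phi x).
Proof.
by move=> mf; rewrite /Rintegral integral_image//; exact/measurable_EFinP.
Qed.

Lemma integrable_image (f : T2 -> \bar R) : measurable_fun setT f ->
  image_measure.-integrable setT f <-> m.-integrable setT (f \o phi).
Proof.
move=> mf; have mfphi : measurable_fun setT (f \o phi) by exact: measurableT_comp.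
have E : (\int[image_measure]_y `|f y| = \int[m]_x `|f (phi x)|)%E.
  by rewrite (ge0_integral_image (f := fun y => `|f y|%E))//; exact: measurableT_comp.
by split=> /integrableP[_ foo]; apply/integrableP; split => //; move: foo; rewrite E.
Qed.

End image_measure.

Section pair_kernel.
Context d d' (T : measurableType d) (T' : measurableType d') (R : realType).
Variable k : R.-pker T ~> T'.

(** The joint law of the parameter and of the sample: integrating it against m
    gives the semidirect product of m and k. *)
Definition pair_kernel (x : T) : {measure set (T * T') -> \bar R} :=
  image_measure (k x) (measurable_pair1 x).

Let measurable_pair_kernel U : measurable U ->
  measurable_fun setT (pair_kernel ^~ U).
Proof.
move=> mU; rewrite (_ : pair_kernel ^~ U = fun x => k x (xsection U x)).
  by apply: measurable_fun_xsection_finite_kernel; rewrite inE.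
apply/funext => x; rewrite /pair_kernel image_measureE; congr (k x _).
by apply/seteqP; split => y /=; rewrite /xsection /= inE.
Qed.

HB.instance Definition _ :=
  isKernel.Build _ _ _ _ R pair_kernel measurable_pair_kernel.

Let pair_kernel_prob p : pair_kernel p setT = 1%E.
Proof. by rewrite /pair_kernel image_measureE preimage_setT prob_kernel. Qed.

HB.instance Definition _ :=
  Kernel_isProbability.Build _ _ _ _ R pair_kernel pair_kernel_prob.

End pair_kernel.

(** * The Markov property in L^2 *)

Lemma eq_measure_rectangles d1 d2 (T1 : measurableType d1)
    (T2 : measurableType d2) (R : realType)
    (m1 m2 : {measure set (T1 * T2) -> \bar R}) :
  (m1 setT < +oo)%E ->
  (forall A B, measurable A -> measurable B -> m1 (A `*` B) = m2 (A `*` B)) ->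
  forall D, measurable D -> m1 D = m2 D.
Proof.
move=> m1oo m12 D mD.
apply: (measure_unique [set A `*` B | A in measurable & B in measurable]
  (fun=> setT)) => //.
- by rewrite measurable_prod_measurableType.
- move=> _ _ [A1 mA1 [B1 mB1 <-]] [A2 mA2 [B2 mB2 <-]].
  exists (A1 `&` A2); first exact: measurableI.
  by exists (B1 `&` B2); [exact: measurableI|rewrite setXI].
- by move=> _; exists setT => //; exists setT => //; rewrite setXTT.
- by rewrite bigcup_const//; exists 0%N.
- by move=> _ [A mA [B mB <-]]; exact: m12.
Qed.

Lemma eq_measure_integrable d (T : measurableType d) (R : realType)
    (m1 m2 : {measure set T -> \bar R}) (f : T -> \bar R) :
  (forall A, measurable A -> m1 A = m2 A) ->
  m1.-integrable setT f -> m2.-integrable setT f.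
Proof.
move=> m12 /integrableP[mf foo]; apply/integrableP; split=> //.
rewrite (_ : (\int[m2]_x `|f x|)%E = (\int[m1]_x `|f x|)%E)//.
by apply: eq_measure_integral => A mA _; rewrite m12.
Qed.

Section precompose_kernel.
Context d0 d d' (T0 : measurableType d0) (T : measurableType d)
  (T' : measurableType d') (R : realType).
Variables (k : R.-pker T ~> T') (h : T0 -> T).

Definition precompose_kernel (mh : measurable_fun setT h) (x : T0) :
  {measure set T' -> \bar R} := k (h x).

Hypothesis mh : measurable_fun setT h.

Let measurable_precompose_kernel U : measurable U ->
  measurable_fun setT (precompose_kernel mh ^~ U).
Proof. by move=> mU; apply: (measurableT_comp (measurable_kernel k U mU)). Qed.

HB.instance Definition _ :=
  isKernel.Build _ _ _ _ R (precompose_kernel mh) measurable_precompose_kernel.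

Let precompose_kernel_prob x : precompose_kernel mh x setT = 1%E.
Proof. exact: prob_kernel. Qed.

HB.instance Definition _ := Kernel_isProbability.Build _ _ _ _ R
  (precompose_kernel mh) precompose_kernel_prob.

End precompose_kernel.

Section markov.
Context d d' (S : measurableType d) (Omega : measurableType d') (R : realType).
Variables (mu : probability S R) (Pr : R.-pker S ~> Omega) (X : R -> Omega -> S).
Hypothesis HX : markov_process Pr X.
Hypothesis Hmu : invariant_measure mu Pr X.

Local Notation P := (start_law mu Pr).

(** Joint measurability is available for nonnegative times only; freezing the
    process before time 0 makes it total without changing the relevant
    values. *)
Lemma measurable_stopped_paths :
  measurable_fun setT (fun p : measurableTypeR R * Omega =>
    X (Num.max 0 p.1) p.2).
Proof.
have mD : measurable [set p : measurableTypeR R * Omega | 0 <= p.1].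
  have -> : [set p : measurableTypeR R * Omega | 0 <= p.1] =
      `[0, +oo[%classic `*` setT.
    by apply/seteqP; split => p /=; rewrite in_itv/= andbT// => -[].
  exact: measurableX.
apply: (measurable_comp mD _ (mp_measurable HX)
  (g := fun p : measurableTypeR R * Omega =>
    (Num.max 0 p.1 : measurableTypeR R, p.2))).
  by move=> _ [p _ <-] /=; rewrite le_max lexx.
apply: measurable_fun_pair => //; apply: measurable_maxr => //.
Qed.

Lemma measurable_path t : 0 <= t -> measurable_fun setT (X t).
Proof.
move=> t0.
have := measurableT_comp measurable_stopped_paths
  (measurable_pair1 (t : measurableTypeR R)).
by rewrite /comp /= max_r.
Qed.

Section law.
Variables (q r s : R).
Hypotheses (q0 : 0 <= q) (qr : q <= r) (r0 : 0 <= r) (s0 : 0 <= s).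

(** The pairs (w, w') where w follows P and w' follows the law of the process
    started from X_r(w). *)
Definition restarted_law : probability (Omega * Omega)%type R :=
  start_law P (pair_kernel (precompose_kernel Pr (measurable_path r0))).

Let mpast_future : measurable_fun setT (fun w => (X q w, X (r + s) w)).
Proof.
apply: measurable_fun_pair; apply: measurable_path => //.
by rewrite addr_ge0.
Qed.

Let mpast_restart :
  measurable_fun setT (fun w : Omega * Omega => (X q w.1, X s w.2)).
Proof.
by apply: measurable_fun_pair; apply: measurableT_comp => //; exact: measurable_path.
Qed.

(** The Markov property as an equality of laws on S * S: after time r the path
    may be replaced by a fresh path started from X_r. Both laws agree on
    rectangles by [mp_markov], which determines them. *)
Lemma markov_pair_law (D : set (S * S)) : measurable D ->
  image_measure P mpast_future D = image_measure restarted_law mpast_restart D.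
Proof.
apply: eq_measure_rectangles.
  rewrite image_measureE preimage_setT.
  exact: (le_lt_trans (probability_le1 (P : probability Omega R) measurableT) (ltry 1)).
move=> A B mA mB.
rewrite !image_measureE /restarted_law.
rewrite [RHS]/= /start_law.
have mXB : measurable (X s @^-1` B).
  by rewrite -[_ @^-1` _]setTI; exact: measurable_path.
rewrite [RHS](_ : _ =
    \int[P]_w ((fun w => Pr (X r w) (X s @^-1` B)) \_ (X q @^-1` A)) w)%E; last first.
  apply: eq_integral => w _; rewrite image_measureE /precompose_kernel patchE.
  case: ifPn; rewrite ?inE ?notin_setE => wA.
    by congr (Pr _ _); apply/seteqP; split => w' //= -[].
  rewrite [X in Pr _ X](_ : _ = set0) ?measure0//.
  by apply/seteqP; split => w' //= -[].
rewrite ge0_integral_start_law//; first last.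
- apply/(measurable_restrictT _ _).1.
    by rewrite -[_ @^-1` _]setTI; apply: measurable_path => //.
  apply: measurable_funTS.
  exact: (measurableT_comp (measurable_kernel Pr _ mXB) (measurable_path r0)).
- by move=> w; rewrite patchE; case: ifPn.
apply: eq_integral => x _.
rewrite -integral_mkcond -(mp_markov HX)//.
apply: sub_sigma_algebra; exists q; first by rewrite /= in_itv/= q0.
by exists A.
Qed.

Lemma integrable_restarted (G : S * S -> R) : measurable_fun setT G ->
  P.-integrable setT (EFin \o (fun w => G (X q w, X (r + s) w))) ->
  restarted_law.-integrable setT
    (EFin \o (fun w : Omega * Omega => G (X q w.1, X s w.2))).
Proof.
move=> /measurable_EFinP mG.
move/(integrable_image P mpast_future mG) => Gi.
apply/(integrable_image restarted_law mpast_restart mG).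
by apply: eq_measure_integrable Gi => D; exact: markov_pair_law.
Qed.

Lemma integral_restarted (G : S * S -> R) : measurable_fun setT G ->
  \int[P]_w G (X q w, X (r + s) w) =
  \int[restarted_law]_w G (X q w.1, X s w.2).
Proof.
move=> mG.
rewrite -(Rintegral_image P mpast_future mG).
rewrite -(Rintegral_image restarted_law mpast_restart mG).
congr fine; apply: eq_measure_integral => D mD _; exact: markov_pair_law.
Qed.

End law.

Lemma integral_path t (t0 : 0 <= t) (f : S -> R) : measurable_fun setT f ->
  \int[P]_w f (X t w) = \int[mu]_x f x.
Proof.
move=> mf; rewrite -(Rintegral_image P (measurable_path t0) mf).
congr fine; apply: eq_measure_integral => D mD _.
by rewrite image_measureE; exact: Hmu.
Qed.

Lemma integrable_path t (t0 : 0 <= t) (f : S -> R) :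
  mu.-integrable setT (EFin \o f) ->
  P.-integrable setT (EFin \o (fun w => f (X t w))).
Proof.
move=> fi; have /integrableP[mf _] := fi.
apply/(integrable_image P (measurable_path t0) mf).
apply: eq_measure_integrable fi => D mD.
by rewrite image_measureE; exact/esym/Hmu.
Qed.

Lemma sqint_path t (t0 : 0 <= t) (f : S -> R) :
  sqint mu f -> sqint P (fun w => f (X t w)).
Proof.
move=> [mf f2]; split.
  exact: measurableT_comp mf (measurable_path t0).
exact: (integrable_path t0 (f := fun x => f x ^+ 2)).
Qed.

Definition real_semigroup (s : R) (f : S -> R) (x : S) : R :=
  \int[Pr x]_w f (X s w).

Lemma measurable_real_semigroup s (f : S -> R) : 0 <= s ->
  measurable_fun setT f -> measurable_fun setT (real_semigroup s f).
Proof.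
move=> s0 mf; apply: (measurable_Rintegral_kernel Pr).
exact: measurableT_comp mf (measurable_path s0).
Qed.

(** With q = r this yields stationarity of correlations, and with q = 0 the
    semigroup property tested against u. *)
Lemma markov_property q r s (u f : S -> R) :
  0 <= q -> q <= r -> 0 <= s -> sqint mu u -> sqint mu f ->
  \int[P]_w (u (X q w) * f (X (r + s) w)) =
  \int[P]_w (u (X q w) * real_semigroup s f (X r w)).
Proof.
move=> q0 qr s0 us fs; have r0 := le_trans q0 qr.
have rs0 : 0 <= r + s by exact: addr_ge0.
have mu_ := us.1; have mf := fs.1.
have mfX : measurable_fun setT (fun w => f (X s w)).
  exact: measurableT_comp mf (measurable_path s0).
have muX : measurable_fun setT (fun w => u (X q w)).
  exact: measurableT_comp mu_ (measurable_path q0).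
have mG1 : measurable_fun setT (fun p : S * S => u p.1 * f p.2).
  by apply: measurable_funM; apply: measurableT_comp.
have mG2 : measurable_fun setT (fun p : S * S => f p.2).
  by apply: measurableT_comp.
have iufX := sqintM (sqint_path q0 us) (sqint_path rs0 fs).
have ifX : P.-integrable setT (EFin \o (fun w => f (X (r + s) w))).
  exact: sqint_integrable (sqint_path rs0 fs).
have := integrable_restarted q0 qr r0 s0 mG1 iufX.
have := integrable_restarted q0 qr r0 s0 mG2 ifX.
rewrite (integral_restarted q0 qr r0 s0 mG1) /= /restarted_law => if2 iuf.
rewrite (integral_start_law iuf).
congr fine; apply: ae_eq_integral => //.
- apply/measurable_EFinP.
  apply: (measurable_Rintegral_kernel
    (pair_kernel (precompose_kernel Pr (measurable_path r0)))).
  by have /integrableP[/measurable_EFinP] := iuf.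
- apply/measurable_EFinP; apply: measurable_funM => //.
  exact: measurableT_comp (measurable_real_semigroup s0 mf) (measurable_path r0).
apply: filterS (ae_integrable_start_law if2) => w.
move/(integrable_image _ (measurable_pair1 w)) => ifw _; congr EFin.
have {}ifw := ifw (iffRL (measurable_EFinP _ _) (measurableT_comp mfX measurable_snd)).
rewrite (Rintegral_image (precompose_kernel Pr (measurable_path r0) w)
  (measurable_pair1 w) (f := fun p : Omega * Omega => u (X q p.1) * f (X s p.2))).
  by rewrite /= (RintegralZl _ measurableT ifw).
by have /integrableP[/measurable_EFinP] := iuf.
Qed.

Definition correlation (u f : S -> R) (r : R) : R :=
  \int[P]_w (u (X 0 w) * f (X r w)).

Lemma correlation0 (u f : S -> R) : sqint mu u -> sqint mu f ->
  correlation u f 0 = \int[mu]_x (u x * f x).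
Proof.
move=> us fs; apply: (integral_path (lexx 0) (f := fun x => u x * f x)).
by apply: measurable_funM; [exact: us.1|exact: fs.1].
Qed.

Lemma l2norm_path t (f : S -> R) : 0 <= t -> sqint mu f ->
  l2norm P (fun w => f (X t w)) = l2norm mu f.
Proof.
move=> t0 fs; congr Num.sqrt; apply: (integral_path t0 (f := fun x => f x ^+ 2)).
by apply: measurable_funX; exact: fs.1.
Qed.

Lemma correlation_bound (u f : S -> R) r : 0 <= r -> sqint mu u -> sqint mu f ->
  `|correlation u f r| <= l2norm mu u * l2norm mu f.
Proof.
move=> r0 us fs; rewrite -(l2norm_path (lexx 0) us) -(l2norm_path r0 fs).
by apply: cauchy_schwarz; exact: sqint_path.
Qed.

Lemma stationarity (u f : S -> R) r s : 0 <= r -> 0 <= s ->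
  sqint mu u -> sqint mu f ->
  \int[P]_w (u (X r w) * f (X (r + s) w)) = correlation u f s.
Proof.
move=> r0 s0 us fs; rewrite markov_property//.
rewrite /correlation -[in RHS](add0r s) markov_property//.
have mh : measurable_fun setT (fun x => u x * real_semigroup s f x).
  by apply: measurable_funM; [exact: us.1|exact: measurable_real_semigroup fs.1].
by rewrite (integral_path r0 mh) (integral_path (lexx 0) mh).
Qed.

(** The bound is uniform in r. For g = f it gives the uniform continuity of
    correlations, and for g = f + s Lf their differentiability. *)
Lemma correlation_shift (u f g : S -> R) r s : 0 <= r -> 0 <= s ->
  sqint mu u -> sqint mu f -> sqint mu g ->
  sqint mu (fun x => real_semigroup s f x - g x) ->
  `|correlation u f (r + s) - correlation u g r| <=
    l2norm mu u * l2norm mu (fun x => real_semigroup s f x - g x).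
Proof.
move=> r0 s0 us fs gs ds.
have us0 := sqint_path (lexx 0) us.
have Ps : sqint mu (real_semigroup s f).
  have := sqintD ds gs; congr sqint; apply/funext => x; ring.
rewrite /correlation markov_property//.
rewrite -RintegralB//; last 2 first.
- exact: sqintM us0 (sqint_path r0 Ps).
- exact: sqintM us0 (sqint_path r0 gs).
under eq_Rintegral do rewrite -mulrBr.
rewrite -(l2norm_path (lexx 0) us) -(l2norm_path r0 ds).
by apply: cauchy_schwarz => //; exact: sqint_path ds.
Qed.

End markov.

(** * A fundamental theorem of calculus from uniform one-sided estimates *)

Section uniform_right_derivative.
Context (R : realType) (c k : R -> R).

Hypothesis k_right : forall e : R, 0 < e -> exists2 dl : R, 0 < dl &
  forall s r : R, 0 < s -> s < dl -> 0 <= r -> `|k (r + s) - k r| <= e.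
Hypothesis c_right : forall e : R, 0 < e -> exists2 dl : R, 0 < dl &
  forall s r : R, 0 < s -> s < dl -> 0 <= r ->
    `|c (r + s) - c r - s * k r| <= e * s.

(** A primitive of k(|x|): extending to the whole line reduces the integral of
    k(|s - r|) across s = r to a single use of the fundamental theorem. *)
Definition odd_extension (x : R) : R :=
  if 0 <= x then c x - c 0 else c 0 - c (- x).
Local Notation G := odd_extension.

Lemma odd_extension_ge0 x : 0 <= x -> G x = c x - c 0.
Proof. by rewrite /G => ->. Qed.

Lemma odd_extensionN x : G (- x) = - G x.
Proof.
rewrite /G oppr_ge0; case: ltrgt0P => // [x0|x0|->].
- by rewrite opprK; ring.
- by ring.
- by rewrite oppr0 subrr oppr0.
Qed.

Lemma even_extension_unif (e : R) : 0 < e -> exists2 dl : R, 0 < dl &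
  forall x y : R, `|y - x| < dl -> `|k `|y| - k `|x| | <= e.
Proof.
move=> e0; have [dl dl0 H] := k_right e0; exists dl => // x y.
wlog xy : x y / `|x| <= `|y|.
  move=> W; have [xy|/ltW yx] := leP `|x| `|y|; first exact: W.
  by rewrite distrC => /(W _ _ yx); rewrite distrC.
move=> yxdl; move: xy; rewrite le_eqVlt => /predU1P[->|xy].
  by rewrite subrr normr0 ltW.
have -> : `|y| = `|x| + (`|y| - `|x|) by ring.
apply: H => //; first by rewrite subr_gt0.
by apply: le_lt_trans yxdl; exact: lerB_dist.
Qed.

(** For x and y of the same sign this is [c_right], or [c_right] and [k_right]
    when y is closer to 0, where the expansion is made at the wrong end point;
    otherwise the increment is split at 0. *)
Lemma odd_extension_taylor (e : R) : 0 < e -> exists2 dl : R, 0 < dl &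
  forall x y : R, `|y - x| < dl -> `|G y - G x - (y - x) * k `|x| | <= e * `|y - x|.
Proof.
move=> e0; have e20 : 0 < e / 2 by rewrite divr_gt0.
have [d1 d10 H1] := c_right e20; have [d2 d20 H2] := even_extension_unif e20.
exists (Num.min d1 d2); first by rewrite lt_min d10.
have pos (x y : R) : `|y - x| < Num.min d1 d2 -> 0 <= x -> 0 <= y ->
    `|G y - G x - (y - x) * k `|x| | <=
      (if x <= y then e / 2 else e) * `|y - x|.
  rewrite lt_min => /andP[yx1 yx2] x0 y0.
  rewrite !odd_extension_ge0// opprB addrA subrK (ger0_norm x0).
  have [xy|yx] := leP x y.
    move: xy; rewrite le_eqVlt => /predU1P[->|xy].
      by rewrite !subrr mul0r subrr normr0 mulr0.
    have s0 : 0 < y - x by rewrite subr_gt0.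
    move: yx1 yx2; rewrite (gtr0_norm s0) => yx1 yx2.
    by have := H1 _ x s0 yx1 x0; rewrite subrKC.
  have s0 : 0 < x - y by rewrite subr_gt0.
  have := H2 _ _ yx2; move: yx1 yx2; rewrite distrC (gtr0_norm s0) => yx1 yx2.
  have := H1 _ y s0 yx1 y0; rewrite subrKC.
  rewrite (ger0_norm x0) (ger0_norm y0) => h1 h2.
  rewrite -normrN (_ : - (c y - c x - (y - x) * k x) = (c x - c y - (x - y) * k y) +
    (x - y) * (k y - k x)); last by ring.
  apply: le_trans (ler_normD _ _) _; rewrite normrM (gtr0_norm s0).
  have := ler_wpM2l (ltW s0) h2; lra.
move=> x y; wlog x0 : x y / 0 <= x.
  move=> W yx; have [x0|/ltW x0] := leP 0 x; first exact: W.
  have yxN : `|- y - - x| = `|y - x| by rewrite -[LHS]normrN; congr `|_|; ring.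
  have := W (- x) (- y); rewrite oppr_ge0 normrN !odd_extensionN yxN.
  move=> /(_ x0 yx); congr (_ <= _).
  by rewrite -[LHS]normrN; congr `|_|; ring.
move=> yx; have [y0|y0] := leP 0 y.
  apply: le_trans (pos _ _ yx x0 y0) _; case: ifP => // _.
  by rewrite ler_wpM2r//; lra.
(* y < 0 <= x: expand from 0 to y by oddness, and from x to 0 *)
have yx' : `|y - x| = x - y by rewrite ltr0_norm ?opprB//; lra.
have Ny0 : 0 <= - y by lra.
have := yx; rewrite yx' lt_min => /andP[yx1 yx2].
have y0dl : `|- y - 0| < Num.min d1 d2.
  by rewrite subr0 ger0_norm// lt_min; apply/andP; split; lra.
have x0dl : `|0 - x| < Num.min d1 d2.
  by rewrite sub0r normrN ger0_norm// lt_min; apply/andP; split; lra.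
have h1 := pos 0 (- y) y0dl (lexx 0) Ny0.
have h2 := pos x 0 x0dl x0 (lexx 0).
have x0d2 : `|x - 0| < d2 by rewrite subr0 ger0_norm//; lra.
have h3 := H2 0 x x0d2.
have G0 : G 0 = 0 by rewrite odd_extension_ge0// subrr.
rewrite Ny0 odd_extensionN G0 !subr0 normr0 (ger0_norm Ny0) in h1.
rewrite G0 !sub0r normrN (ger0_norm x0) in h2.
have {}h2 : `|- G x - - x * k x| <= e * x.
  by apply: le_trans h2 _; case: ifP => // _; rewrite ler_wpM2r//; lra.
rewrite (ger0_norm x0) normr0 in h3; rewrite (ger0_norm x0).
rewrite (_ : _ - _ = - (- G y - - y * k 0) + (- G x - - x * k x) +
  - y * (k x - k 0)); last by ring.
apply: le_trans (ler_normD _ _) _.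
apply: le_trans (lerD (ler_normD _ _) (lexx _)) _.
rewrite normrN normrM (ger0_norm Ny0).
have := ler_wpM2l Ny0 h3; lra.
Qed.

Lemma is_derive_odd_extension (r x : R) :
  is_derive x 1 (fun s => G (s - r)) (k `|x - r|).
Proof.
suff H : h^-1 *: (G (h *: 1 + x - r) - G (x - r)) @[h --> 0^'] --> k `|x - r|.
  by apply: DeriveDef; [apply/cvg_ex; exists (k `|x - r|)|exact/cvg_lim].
apply/cvgrPdist_le => /= e e0.
have [dl dl0 H] := odd_extension_taylor e0.
near=> h.
have h0 : h != 0 by near: h; exact: nbhs_dnbhs_neq.
have hdl : `|h| < dl by near: h; exact: dnbhs0_lt.
have := H (x - r) (h + (x - r)); rewrite addrK => /(_ hdl).
rewrite distrC scaler1 -(addrA h) -ler_pdivrMr ?normr_gt0// -normfV -normrM.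
by rewrite /GRing.scale/= mulrBl mulrAC mulfV// mul1r [_ * h^-1]mulrC.
Unshelve. all: by end_near. Qed.

Lemma Rintegral_even_extension (a b r : R) : a <= b ->
  \int[lebesgue_measure]_(s in `[a, b]) k `|s - r| = G (b - r) - G (a - r).
Proof.
rewrite le_eqVlt => /predU1P[->|ab].
  by rewrite set_itv1 Rintegral_set1 subrr.
have dG := is_derive_odd_extension r.
have cG : continuous (fun s => G (s - r)).
  by move=> s; apply/differentiable_continuous/derivable1_diffP; case: (dG s).
rewrite /Rintegral (continuous_FTC2 (F := fun s => G (s - r)) ab)//.
- apply: continuous_subspaceT => s; apply/cvgrPdist_le => /= e e0.
  have [dl dl0 H] := even_extension_unif e0.
  near=> u; rewrite distrC; apply: H; rewrite opprB addrA subrK distrC.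
  by near: u; apply: cvgr_dist_lt.
- split; first by move=> s _; case: (dG s).
  + exact: cvg_at_right_filter (cG a).
  + exact: cvg_at_left_filter (cG b).
- by move=> s _; rewrite derive1E; case: (dG s).
Unshelve. all: by end_near. Qed.

End uniform_right_derivative.

(** * Time integrals of the process *)

Section time_integral.
Context d d' (S : measurableType d) (Omega : measurableType d') (R : realType).
Variables (mu : probability S R) (Pr : R.-pker S ~> Omega) (X : R -> Omega -> S).
Hypothesis HX : markov_process Pr X.
Hypothesis Hmu : invariant_measure mu Pr X.

Local Notation P := (start_law mu Pr).
Local Notation lambda := (@lebesgue_measure R).

Definition time_integral (t : R) (g : S -> R) (w : Omega) : R :=
  \int[lambda]_(s in `[0, t]) g (X s w).

Section fixed_time.
Variables (t : R) (g : S -> R).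
Hypotheses (t0 : 0 < t) (gs : sqint mu g).

Let F (p : measurableTypeR R * Omega) : R :=
  ((fun s => g (X s p.2)) \_ `[0, t]) p.1.

Let FE s w : s \in `[0, t] -> F (s, w) = g (X s w).
Proof. by move=> st; rewrite /F patchE mem_set. Qed.

Let F0 s w : s \notin `[0, t] -> F (s, w) = 0.
Proof. by move=> st; rewrite /F patchE memNset//; exact/negP. Qed.

Let mF : measurable_fun setT F.
Proof.
have -> : F = (fun p => \1_(`[0, t]) p.1 * g (X (Num.max 0 p.1) p.2)).
  apply/funext => -[s w] /=; rewrite indicE.
  have [st|st] := boolP (s \in `[0, t]).
    rewrite FE// mem_set// mul1r max_r//.
    by move: st; rewrite in_itv/= => /andP[].
  by rewrite F0// memNset ?mul0r//; exact/negP.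
apply: measurable_funM.
  by apply: measurableT_comp => //; exact: measurable_indic.
exact: measurableT_comp gs.1 (measurable_stopped_paths HX).
Qed.

Lemma time_integralE w : time_integral t g w = \int[lambda]_s F (s, w).
Proof. by rewrite /time_integral Rintegral_mkcond. Qed.

Let integrable_weighted (Z : Omega -> R) : sqint P Z ->
  (lambda \x P)%E.-integrable setT
    (EFin \o (fun p : measurableTypeR R * Omega => Z p.2 * F p)).
Proof.
move=> Zs.
have mZF : measurable_fun setT
    (fun p : measurableTypeR R * Omega => (Z p.2 * F p)%:E).
  apply/measurable_EFinP; apply: measurable_funM => //.
  exact: measurableT_comp Zs.1 _.
apply/integrable12ltyP => //.
have cst_fin : (\int[lambda]_(s in `[0%R, t]) (l2norm P Z * l2norm mu g)%:E < +oo)%E.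
  rewrite integral_cst//= lebesgue_measure_itv/= lte_fin t0 -EFinD -EFinM.
  exact: ltry.
apply: le_lt_trans cst_fin.
rewrite [leRHS]integral_mkcond.
apply: ge0_le_integral => //.
- by move=> s _; exact: integral_ge0.
- apply: (measurable_fun_fubini_tonelli_F (m2 := P)
    ( fun p => `|(Z p.2 * F p)%:E|%E)) => //.
  exact: measurableT_comp mZF.
- by apply/(measurable_restrictT _ _).1 => //; exact: measurable_cst.
- move=> s _; rewrite patchE; case: ifPn => [|].
    rewrite inE/= => st.
    have s0 : 0 <= s by move: st; rewrite in_itv/= => /andP[].
    under eq_integral do rewrite FE//.
    rewrite -(l2norm_path HX Hmu s0 gs).
    exact: (ge0_cauchy_schwarz Zs (sqint_path HX Hmu s0 gs)).
  move=> /negP sN; rewrite integral0_eq//= => w _.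
  by rewrite F0 ?mulr0 ?normr0//; apply/negP => st; apply: sN; exact: mem_set.
Qed.

Let integrable_F : (lambda \x P)%E.-integrable setT (EFin \o F).
Proof.
have := integrable_weighted (sqint_cst P 1).
by apply: eq_integrable => // p _; rewrite /= mul1r.
Qed.

Lemma measurable_time_integral : measurable_fun setT (time_integral t g).
Proof.
have := measurable_fubini_G integrable_F => mG.
rewrite (_ : time_integral t g = fine \o fubini_G lambda (EFin \o F)).
  exact: measurableT_comp.
by apply/funext => w; rewrite time_integralE.
Qed.

(** Fubini. The time integral of a path is meaningful for almost every path
    only; testing against Z ignores the exceptional ones. *)
Lemma integral_mul_time_integral (Z : Omega -> R) : sqint P Z ->
  \int[P]_w (Z w * time_integral t g w) =
  \int[lambda]_(s in `[0, t]) \int[P]_w (Z w * g (X s w)).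
Proof.
move=> Zs; have iZF := integrable_weighted Zs.
have := Fubini iZF => /(congr1 fine).
rewrite [RHS](_ : _ = \int[P]_w (Z w * time_integral t g w)); last first.
  congr fine; apply: ae_eq_integral => //.
  - exact: (measurable_fubini_G iZF).
  - apply/measurable_EFinP; apply: measurable_funM => //; first exact: Zs.1.
    exact: measurable_time_integral.
  apply: filterS (ae_integrable2 integrable_F) => w iFw _.
  rewrite time_integralE -RintegralZl//.
  rewrite fineK//; apply: integrable_fin_num => //.
  exact: (integrable_scale (Z w) iFw).
move=> <-; rewrite Rintegral_mkcond; congr fine; apply: eq_integral => s _.
rewrite patchE; case: ifPn => [|].
- rewrite inE/= => st.
  have s0 : 0 <= s by move: st; rewrite in_itv/= => /andP[].
  have iZg := sqintM Zs (sqint_path HX Hmu s0 gs).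
  under eq_integral do rewrite /= FE//.
  by rewrite fineK//; exact: integrable_fin_num iZg.
- move=> /negP sN; rewrite integral0_eq//= => w _.
  by rewrite F0 ?mulr0//; apply/negP => st; apply: sN; exact: mem_set.
Qed.

Lemma integrable_mul_path (Z : Omega -> R) : sqint P Z ->
  lambda.-integrable `[0, t] (EFin \o (fun s => \int[P]_w (Z w * g (X s w)))).
Proof.
move=> Zs; have iZF := integrable_weighted Zs.
have iI : lambda.-integrable `[0, t] (fubini_F P (fun p => (Z p.2 * F p)%:E)).
  by apply: integrableS (integrable_fubini_F iZF).
move: iI.
apply: eq_integrable => // s /set_mem st.
have s0 : 0 <= s by move: st; rewrite /= in_itv/= => /andP[].
have iZg := sqintM Zs (sqint_path HX Hmu s0 gs).
rewrite /fubini_F /=; under eq_integral do rewrite FE//.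
by rewrite fineK//; exact: integrable_fin_num iZg.
Qed.

(** For each path the square of the time integral is at most t times the time
    integral of g^2, by Cauchy-Schwarz against the indicator of [0, t]. *)
Lemma sqint_time_integral : sqint P (time_integral t g).
Proof.
split; first exact: measurable_time_integral.
apply/integrableP; split.
  apply/measurable_EFinP; apply: measurable_funX.
  exact: measurable_time_integral.
have mFw w : measurable_fun setT (fun s => F (s, w)).
  exact: measurableT_comp mF (measurable_pair2 w).
have F2_fin : (\int[lambda]_s \int[P]_w ((F (s, w)) ^+ 2)%:E < +oo)%E.
  rewrite (_ : (\int[lambda]_s _)%E =
      (\int[lambda]_(s in `[0%R, t]) (\int[mu]_x (g x ^+ 2))%:E)%E).
    rewrite integral_cst//= lebesgue_measure_itv/= lte_fin t0 -EFinD -EFinM.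
    exact: ltry.
  rewrite [RHS]integral_mkcond; apply: eq_integral => s _.
  rewrite patchE; case: ifPn => [|].
    rewrite inE/= => st.
    have s0 : 0 <= s by move: st; rewrite in_itv/= => /andP[].
    under eq_integral do rewrite FE//.
    have mg2 : measurable_fun setT (fun x => g x ^+ 2).
      by apply: measurable_funX; exact: gs.1.
    rewrite -(integral_path HX Hmu s0 mg2) fineK//.
    by apply: integrable_fin_num => //; exact: (sqint_path HX Hmu s0 gs).2.
  move=> /negP sN; rewrite integral0_eq//= => w _.
  by rewrite F0 ?expr0n//; apply/negP => st; apply: sN; exact: mem_set.
have mF2 : measurable_fun setT
    (fun p : measurableTypeR R * Omega => ((F p) ^+ 2)%:E).
  by apply/measurable_EFinP; exact: measurable_funX.
have F20 (p : measurableTypeR R * Omega) : (0 <= ((F p) ^+ 2)%:E)%E.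
  by rewrite lee_fin sqr_ge0.
rewrite (fubini_tonelli (fun p => ((F p) ^+ 2)%:E))// in F2_fin.
have mIF2 : measurable_fun setT (fun w => \int[lambda]_s ((F (s, w)) ^+ 2)%:E)%E.
  exact: (measurable_fun_fubini_tonelli_G (m1 := lambda)
    (fun p => ((F p) ^+ 2)%:E)).
apply: (@le_lt_trans _ _
    (t%:E * \int[P]_w \int[lambda]_s ((F (s, w)) ^+ 2)%:E)%E); last first.
  by rewrite lte_mul_pinfty// lee_fin ltW.
rewrite -ge0_integralZl//; first last.
- by rewrite lee_fin ltW.
- by move=> w _; exact: integral_ge0.
apply: ge0_le_integral => //.
- apply: measurableT_comp => //; apply/measurable_EFinP.
  by apply: measurable_funX; exact: measurable_time_integral.
- exact: measurable_funeM.
move=> w _; rewrite gee0_abs ?lee_fin ?sqr_ge0//.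
have [F2oo|F2fin] := eqVneq (\int[lambda]_s ((F (s, w)) ^+ 2)%:E)%E +oo%E.
  by rewrite F2oo gt0_muley ?lte_fin// leey.
have Fs : sqint lambda (fun s => F (s, w)).
  split=> //; apply/integrableP; split.
    by apply/measurable_EFinP; exact: measurable_funX.
  under eq_integral do rewrite gee0_abs ?lee_fin ?sqr_ge0//.
  by rewrite -ltey in F2fin.
have m01 : measurable `[0, t] by [].
have ind2 s : (\1_(`[0, t]) s : R) ^+ 2 = \1_(`[0, t]) s.
  by rewrite indicE; case: (_ \in _); rewrite ?expr1n ?expr0n.
have indE : \int[lambda]_s ((\1_(`[0, t]) s : R) ^+ 2) = t.
  under eq_Rintegral do rewrite ind2.
  rewrite /Rintegral integral_indic// setIT.
  have lt : lambda [set` `[0%R, t]%R] = t%:E.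
    by rewrite lebesgue_measure_itv/= lte_fin t0 -EFinD subr0.
  exact: (congr1 fine lt).
have ind_s : sqint lambda (\1_(`[0, t])).
  split; first exact: measurable_indic.
  by apply: eq_integrable (integrable_indic_itv 0 t true false) => // s _ /=; rewrite ind2.
have := cauchy_schwarz ind_s Fs.
rewrite {1}/l2norm indE.
under eq_Rintegral.
  move=> s _; rewrite (_ : _ * _ = F (s, w)); last first.
    have [st|/negP st] := boolP (s \in `[0, t]).
      by rewrite indicE mem_set// mul1r.
    by rewrite F0 ?mulr0//; exact/negP.
  over.
have F2_ge0 : 0 <= \int[lambda]_s (F (s, w) ^+ 2).
  by apply: Rintegral_ge0 => s _; exact: sqr_ge0.
rewrite -time_integralE -ler_sqr ?nnegrE ?mulr_ge0 ?sqrtr_ge0//.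
rewrite real_normK ?num_real// exprMn (sqr_sqrtr (ltW t0)) (sqr_sqrtr F2_ge0).
move=> H; rewrite -(fineK (integrable_fin_num measurableT Fs.2)) -EFinM lee_fin.
exact: H.
Qed.

End fixed_time.
End time_integral.

(** * Bounds for real functions *)

Section real_bounds.
Context d d' (S : measurableType d) (Omega : measurableType d') (R : realType).
Variables (mu : probability S R) (Pr : R.-pker S ~> Omega) (X : R -> Omega -> S).
Hypothesis HX : markov_process Pr X.
Hypothesis Hmu : invariant_measure mu Pr X.

Local Notation P := (start_law mu Pr).
Local Notation lambda := (@lebesgue_measure R).
Local Notation corr := (correlation mu Pr X).
Local Notation I := (@time_integral _ _ S Omega R X).

(** Strong continuity at f, including that P_s f is in L^2 for small s. *)
Definition right_continuous_orbit (f : S -> R) : Prop :=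
  forall e : R, 0 < e -> exists2 dl : R, 0 < dl & forall s, 0 < s -> s < dl ->
    sqint mu (fun x => real_semigroup Pr X s f x - f x) /\
    l2norm mu (fun x => real_semigroup Pr X s f x - f x) <= e.

(** h = Lf, in the form of a first-order expansion of P_s f. *)
Definition real_generator (f h : S -> R) : Prop :=
  forall e : R, 0 < e -> exists2 dl : R, 0 < dl & forall s, 0 < s -> s < dl ->
    sqint mu (fun x => real_semigroup Pr X s f x - (f x + s * h x)) /\
    l2norm mu (fun x => real_semigroup Pr X s f x - (f x + s * h x)) <= e * s.

Section dynkin.
Variables u f h : S -> R.
Hypotheses (us : sqint mu u) (fs : sqint mu f) (hs : sqint mu h).
Hypotheses (fh : real_generator f h) (hc : right_continuous_orbit h).

Let l2_ge0 (g : S -> R) : 0 <= l2norm mu g. Proof. exact: sqrtr_ge0. Qed.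

Lemma correlation_right (e : R) : 0 < e -> exists2 dl : R, 0 < dl &
  forall s r : R, 0 < s -> s < dl -> 0 <= r ->
    `|corr u h (r + s) - corr u h r| <= e.
Proof.
move=> e0; have u0 : 0 < l2norm mu u + 1 by rewrite ltr_wpDl.
have [dl dl0 H] := hc (divr_gt0 e0 u0).
exists dl => // s r s0 sdl r0; have [ds dle] := H _ s0 sdl.
apply: le_trans (correlation_shift HX Hmu r0 (ltW s0) us hs hs ds) _.
apply: le_trans (ler_wpM2l (l2_ge0 u) dle) _.
by rewrite mulrCA ler_piMr ?(ltW e0)// ler_pdivrMr// mul1r lerDl.
Qed.

Lemma correlationDZ (s r : R) : 0 <= r ->
  corr u (fun x => f x + s * h x) r = corr u f r + s * corr u h r.
Proof.
move=> r0; have us0 := sqint_path HX Hmu (lexx 0) us.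
have fr := sqint_path HX Hmu r0 fs; have hr := sqint_path HX Hmu r0 hs.
rewrite /correlation; under eq_Rintegral do rewrite mulrDr mulrCA.
rewrite RintegralD//.
- by rewrite RintegralZl//; exact: sqintM us0 hr.
- exact: sqintM us0 fr.
- exact: integrable_scale (sqintM us0 hr).
Qed.

Lemma correlation_taylor (e : R) : 0 < e -> exists2 dl : R, 0 < dl &
  forall s r : R, 0 < s -> s < dl -> 0 <= r ->
    `|corr u f (r + s) - corr u f r - s * corr u h r| <= e * s.
Proof.
move=> e0; have u0 : 0 < l2norm mu u + 1 by rewrite ltr_wpDl.
have [dl dl0 H] := fh (divr_gt0 e0 u0).
exists dl => // s r s0 sdl r0; have [ds dle] := H _ s0 sdl.
have gs : sqint mu (fun x => f x + s * h x) := sqintD fs (sqintZ s hs).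
have := correlation_shift HX Hmu r0 (ltW s0) us fs gs ds.
rewrite correlationDZ// opprD addrA => /le_trans; apply.
apply: le_trans (ler_wpM2l (l2_ge0 u) dle) _.
rewrite mulrA ler_wpM2r ?(ltW s0)//.
by rewrite mulrCA ler_piMr ?(ltW e0)// ler_pdivrMr// mul1r lerDl.
Qed.

(** Dynkin's formula tested against u(X_0). *)
Lemma dynkin t : 0 <= t ->
  \int[lambda]_(s in `[0, t]) corr u h s = corr u f t - corr u f 0.
Proof.
move=> t0.
have := Rintegral_even_extension correlation_right correlation_taylor 0 t0.
rewrite !subr0 !odd_extension_ge0// subrr subr0 => <-.
apply: eq_Rintegral => s; rewrite inE/= in_itv/= => /andP[s0 _].
by rewrite subr0 ger0_norm.
Qed.

Lemma two_sided_dynkin r t : 0 <= r -> r <= t ->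
  \int[lambda]_(s in `[0, t]) corr u h `|s - r| =
  (corr u f r - corr u f 0) + (corr u f (t - r) - corr u f 0).
Proof.
move=> r0 rt; have t0 := le_trans r0 rt.
rewrite (Rintegral_even_extension correlation_right correlation_taylor)//.
rewrite sub0r odd_extensionN opprK addrC !odd_extension_ge0 ?subr_ge0//.
Qed.

End dynkin.

(** By Fubini the left-hand side is the integral over r in [0, t] of the inner
    integral in [two_sided_dynkin] for u = h, which consists of four
    correlations of h and f. *)
Lemma time_integral_variance (f h : S -> R) t :
  sqint mu f -> sqint mu h -> real_generator f h -> right_continuous_orbit h ->
  0 < t -> \int[P]_w (I t h w ^+ 2) <= 4 * t * (l2norm mu h * l2norm mu f).
Proof.
move=> fs hs fh hc t0; set M := l2norm mu h * l2norm mu f.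
have Is := sqint_time_integral HX Hmu t0 hs.
under eq_Rintegral do rewrite expr2.
rewrite (integral_mul_time_integral HX Hmu t0 hs Is).
have <- : \int[lambda]_(s in `[0, t]) (4 * M) = 4 * t * M.
  rewrite Rintegral_cst//= lebesgue_measure_itv/= lte_fin t0 -EFinD/= subr0.
  by ring.
apply: le_Rintegral => //.
- exact: (integrable_mul_path HX Hmu t0 hs Is).
- apply: continuous_compact_integrable => //; first exact: segment_compact.
  by apply: continuous_subspaceT => x; exact: cvg_cst.
move=> r; rewrite /= in_itv/= => /andP[r0 rt].
have hrs := sqint_path HX Hmu r0 hs.
under eq_Rintegral do rewrite mulrC.
rewrite (integral_mul_time_integral HX Hmu t0 hs hrs).
have -> : \int[lambda]_(s in `[0, t]) \int[P]_w (h (X r w) * h (X s w)) =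
    \int[lambda]_(s in `[0, t]) corr h h `|s - r|.
  apply: eq_Rintegral => s; rewrite inE/= in_itv/= => /andP[s0 st].
  have [rs|/ltW sr] := leP r s.
    have sr0 : 0 <= s - r by rewrite subr_ge0.
    by rewrite ger0_norm// -(stationarity HX Hmu r0 sr0 hs hs) subrKC.
  have rs0 : 0 <= r - s by rewrite subr_ge0.
  rewrite distrC ger0_norm// -(stationarity HX Hmu s0 rs0 hs hs) subrKC.
  by apply: eq_Rintegral => w _; rewrite mulrC.
rewrite (two_sided_dynkin hs fs hs fh hc r0 rt).
have tr0 : 0 <= t - r by rewrite subr_ge0.
have := correlation_bound HX Hmu r0 hs fs.
have := correlation_bound HX Hmu tr0 hs fs.
have := correlation_bound HX Hmu (lexx 0) hs fs.
rewrite -/M !ler_norml => /andP[? ?] /andP[? ?] /andP[? ?]; lra.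
Qed.

Lemma continuous_integrable_itv_oc (a b : R) (g : R -> R) : continuous g ->
  lambda.-integrable `]a, b] (EFin \o g).
Proof.
move=> cg; have ig : lambda.-integrable `[a, b] (EFin \o g).
  apply: continuous_compact_integrable => //; first exact: segment_compact.
  exact: continuous_subspaceT.
by apply: integrableS ig => //; exact: subset_itv_oc_cc.
Qed.

Lemma Rintegral_itv_id (a b : R) : 0 <= a -> a <= b ->
  \int[lambda]_(s in `]a, b]) s = (b ^+ 2 - a ^+ 2) / 2.
Proof.
move=> a0 ab; rewrite Rintegral_itv_obnd_cbnd; last first.
  by apply: continuous_integrable_itv_oc => x; exact: cvg_id.
have := @Rintegral_even_extension R (fun x => x ^+ 2 / 2) id _ _ a b 0 ab.
rewrite !subr0 !odd_extension_ge0//; last exact: le_trans ab.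
move=> H; transitivity (\int[lambda]_(s in `[a, b]) `|s - 0|).
  apply: eq_Rintegral => s; rewrite inE/= in_itv/= => /andP[sa _].
  by rewrite subr0 ger0_norm//; exact: le_trans sa.
rewrite H; first by field.
- move=> e e0; exists e => // s r s0 se r0 /=.
  by rewrite addrAC subrr add0r gtr0_norm// ltW.
- move=> e e0; exists e => // s r s0 se r0 /=.
  rewrite (_ : _ - _ = s ^+ 2 / 2); last by field.
  by rewrite ger0_norm ?mulr_ge0 ?sqr_ge0//; nra.
Qed.

Section relaxation.
Variables f1 f2 h1 h2 : S -> R.
Hypotheses (f1s : sqint mu f1) (f2s : sqint mu f2).
Hypotheses (h1s : sqint mu h1) (h2s : sqint mu h2).
Hypotheses (fh1 : real_generator f1 h1) (fh2 : real_generator f2 h2).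
Hypotheses (hc1 : right_continuous_orbit h1) (hc2 : right_continuous_orbit h2).

Let nf := Num.sqrt (\int[mu]_x (f1 x ^+ 2) + \int[mu]_x (f2 x ^+ 2)).
Let c s := corr f1 f1 s + corr f2 f2 s.

Let c0 : c 0 = nf ^+ 2.
Proof.
rewrite /c !(correlation0 HX Hmu)// /nf sqr_sqrtr//.
by rewrite addr_ge0// Rintegral_ge0// => x _; rewrite sqr_ge0.
Qed.

(** Cauchy-Schwarz between the starting point and the time integrals, after
    exchanging time integral and expectation. *)
Let start_bound (g1 g2 : S -> R) s M : 0 < s -> sqint mu g1 -> sqint mu g2 ->
  Num.sqrt (\int[P]_w (I s g1 w ^+ 2) + \int[P]_w (I s g2 w ^+ 2)) <= M ->
  `|\int[lambda]_(r in `[0, s]) corr f1 g1 r +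
    \int[lambda]_(r in `[0, s]) corr f2 g2 r| <= nf * M.
Proof.
move=> s0 g1s g2s gM.
have f10 := sqint_path HX Hmu (lexx 0) f1s.
have f20 := sqint_path HX Hmu (lexx 0) f2s.
have I1 := sqint_time_integral HX Hmu s0 g1s.
have I2 := sqint_time_integral HX Hmu s0 g2s.
rewrite -(integral_mul_time_integral HX Hmu s0 g1s f10).
rewrite -(integral_mul_time_integral HX Hmu s0 g2s f20).
apply: le_trans (cauchy_schwarz2 f10 I1 f20 I2) _.
have mf1 : measurable_fun setT (fun x => f1 x ^+ 2).
  by apply: measurable_funX; exact: f1s.1.
have mf2 : measurable_fun setT (fun x => f2 x ^+ 2).
  by apply: measurable_funX; exact: f2s.1.
rewrite (integral_path HX Hmu (lexx 0) mf1) (integral_path HX Hmu (lexx 0) mf2).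
by rewrite ler_wpM2l// sqrtr_ge0.
Qed.

Let integrable_c s : 0 < s -> lambda.-integrable `[0, s] (EFin \o c).
Proof.
move=> s0.
have i1 := integrable_mul_path HX Hmu s0 f1s (sqint_path HX Hmu (lexx 0) f1s).
have i2 := integrable_mul_path HX Hmu s0 f2s (sqint_path HX Hmu (lexx 0) f2s).
by apply: eq_integrable (integrableD _ i1 i2).
Qed.

(** The correlation of f with itself cannot stay close to its initial value
    |f|^2, because its time average is controlled by B, and cannot leave it
    quickly, because its derivative is controlled by A. Here (f1, f2) and
    (h1, h2) are the parts of f and Lf, and the hypotheses bound the time
    integrals by s A and s B. *)
Lemma relaxation_lower_bound (t A B : R) : 0 < t ->
  (forall s, t <= s -> s <= 2 * t ->
    Num.sqrt (\int[P]_w (I s h1 w ^+ 2) + \int[P]_w (I s h2 w ^+ 2)) <= s * A) ->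
  (forall s, t <= s -> s <= 2 * t ->
    Num.sqrt (\int[P]_w (I s f1 w ^+ 2) + \int[P]_w (I s f2 w ^+ 2)) <= s * B) ->
  t * nf <= 3 / 2 * t ^+ 2 * A + 3 * t * B.
Proof.
move=> t0 hA hB; have tt : t <= 2 * t by lra. have tt0 : 0 < 2 * t by lra.
have nf0 : 0 <= nf by exact: sqrtr_ge0.
have [->|nfN0] := eqVneq nf 0.
  have A0 : 0 <= t * A by apply: le_trans (hA _ (lexx t) tt); exact: sqrtr_ge0.
  have B0 : 0 <= t * B by apply: le_trans (hB _ (lexx t) tt); exact: sqrtr_ge0.
  by rewrite mulr0; nra.
have nfp : 0 < nf by rewrite lt_neqAle eq_sym nfN0.
rewrite -(ler_pM2l nfp).
have decay s : t <= s -> s <= 2 * t -> nf ^+ 2 - c s <= nf * (s * A).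
  move=> ts st; have s0 : 0 < s by lra.
  have := start_bound s0 h1s h2s (hA s ts st).
  rewrite (dynkin f1s f1s h1s fh1 hc1 (ltW s0)).
  rewrite (dynkin f2s f2s h2s fh2 hc2 (ltW s0)).
  by rewrite -c0 /c ler_norml => /andP[? _]; lra.
have average s : t <= s -> s <= 2 * t ->
    `|\int[lambda]_(r in `[0, s]) c r| <= nf * (s * B).
  move=> ts st; have s0 : 0 < s by lra.
  have := start_bound s0 f1s f2s (hB s ts st).
  rewrite -RintegralD//.
  - exact: (integrable_mul_path HX Hmu s0 f1s (sqint_path HX Hmu (lexx 0) f1s)).
  - exact: (integrable_mul_path HX Hmu s0 f2s (sqint_path HX Hmu (lexx 0) f2s)).
have ic := integrable_c tt0.
have split_c := Rintegral_itvB ic (x := t).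
rewrite !bnd_simp in split_c. have {}split_c := split_c (ltW t0) tt.
have ic' : lambda.-integrable `]t, 2 * t] (EFin \o c).
  by apply: integrableS ic => //; apply: subset_itvr; rewrite bnd_simp ltW.
have icst : lambda.-integrable `]t, 2 * t] (EFin \o cst (nf ^+ 2)).
  by apply: continuous_integrable_itv_oc => x; exact: cvg_cst.
have ilin : lambda.-integrable `]t, 2 * t] (EFin \o (fun s => (nf * A) * s)).
  by apply: continuous_integrable_itv_oc; exact: mulrl_continuous.
have : \int[lambda]_(s in `]t, 2 * t]) (nf ^+ 2 - c s) <=
       \int[lambda]_(s in `]t, 2 * t]) ((nf * A) * s).
  apply: le_Rintegral => //.
    by apply: eq_integrable (integrableB _ icst ic').
  move=> s; rewrite /= in_itv/= => /andP[ts st].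
  by have := decay s (ltW ts) st; lra.
rewrite RintegralB// Rintegral_cst//= lebesgue_measure_itv/= lte_fin.
rewrite (_ : t < 2 * t)/=; last by lra.
rewrite RintegralZl//; last first.
  by apply: continuous_integrable_itv_oc => x; exact: cvg_id.
rewrite Rintegral_itv_id ?(ltW t0)//.
have := average _ (lexx t) tt; have := average _ tt (lexx _).
rewrite -split_c !ler_norml => /andP[? ?] /andP[? ?]; lra.
Qed.

End relaxation.

End real_bounds.

(** * Complex functions and their parts *)

Section complex_L2.
Context d (T : measurableType d) (R : realType).
Variable m : {measure set T -> \bar R}.
Implicit Types f g h : T -> R[i].

Definition re_part f (x : T) : R := complex.Re (f x).
Definition im_part f (x : T) : R := complex.Im (f x).

Definition complex_l2norm f : R :=
  Num.sqrt (\int[m]_x (re_part f x ^+ 2) + \int[m]_x (im_part f x ^+ 2)).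

Lemma sqr_normc_parts (z : R[i]) :
  normc z ^+ 2 = complex.Re z ^+ 2 + complex.Im z ^+ 2.
Proof. by case: z => a b; rewrite sqr_sqrtr// addr_ge0 ?sqr_ge0. Qed.

Lemma normc_ge0 (z : R[i]) : 0 <= normc z.
Proof. by case: z => a b; exact: sqrtr_ge0. Qed.

Lemma L2normE f :
  L2norm m f = sqrte (\int[m]_x (re_part f x ^+ 2 + im_part f x ^+ 2)%:E)%E.
Proof.
rewrite /L2norm unlock poweR12_sqrt; last first.
  by apply: integral_ge0 => x _; rewrite poweR_ge0.
congr sqrte; apply: eq_integral => x _ /=.
by rewrite powR_mulrn// ger0_norm ?normc_ge0// sqr_normc_parts.
Qed.

Lemma measurable_sum_sqr f : cmeasurable f ->
  measurable_fun setT (fun x => (re_part f x ^+ 2 + im_part f x ^+ 2)%:E).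
Proof.
by move=> [mr mi]; apply/measurable_EFinP; apply: measurable_funD;
  exact: measurable_funX.
Qed.

Lemma sqint_parts f : cmeasurable f -> (L2norm m f < +oo)%E ->
  sqint m (re_part f) /\ sqint m (im_part f).
Proof.
move=> mf; rewrite L2normE => foo.
have ige0 : (0 <= \int[m]_x (re_part f x ^+ 2 + im_part f x ^+ 2)%:E)%E.
  by apply: integral_ge0 => x _; rewrite lee_fin addr_ge0 ?sqr_ge0.
have fi : m.-integrable setT (EFin \o (fun x => re_part f x ^+ 2 + im_part f x ^+ 2)).
  apply/integrableP; split; first exact: measurable_sum_sqr.
  under eq_integral do rewrite gee0_abs ?lee_fin ?addr_ge0 ?sqr_ge0//.
  rewrite -ge0_fin_numE// -sqrte_fin_num// ge0_fin_numE//.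
  exact: sqrte_ge0.
case: mf => mr mi; split; split => //.
- apply: le_integrable fi => //.
    by apply/measurable_EFinP; exact: measurable_funX.
  by move=> x _; rewrite lee_fin !ger0_norm ?addr_ge0 ?sqr_ge0// lerDl sqr_ge0.
- apply: le_integrable fi => //.
    by apply/measurable_EFinP; exact: measurable_funX.
  by move=> x _; rewrite lee_fin !ger0_norm ?addr_ge0 ?sqr_ge0// lerDr sqr_ge0.
Qed.

Lemma L2norm_fin f : sqint m (re_part f) -> sqint m (im_part f) ->
  L2norm m f = (complex_l2norm f)%:E.
Proof.
move=> [mr ir] [mi ii]; rewrite L2normE /complex_l2norm.
have := integrable_add ir ii => irii.
rewrite -RintegralD// -(fineK (integrable_fin_num measurableT irii)).
by [].
Qed.

Lemma L2P f : L2 m f <-> sqint m (re_part f) /\ sqint m (im_part f).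
Proof.
split=> [[mf foo]|[rs is_]]; first exact: sqint_parts.
by split; [split; [exact: rs.1|exact: is_.1]|rewrite L2norm_fin// ltry].
Qed.

Lemma l2norm_parts_le f :
  l2norm m (re_part f) <= complex_l2norm f /\ l2norm m (im_part f) <= complex_l2norm f.
Proof.
have sq0 (g : T -> R) : 0 <= \int[m]_x (g x ^+ 2).
  by rewrite Rintegral_ge0// => x _; rewrite sqr_ge0.
by split; rewrite ler_sqrt ?addr_ge0// ?lerDl ?lerDr.
Qed.

(** Measurability must be assumed: the norm of a nonmeasurable function may be
    small by accident. *)
Lemma small_parts f (e : R) : cmeasurable f -> (L2norm m f < e%:E)%E ->
  [/\ sqint m (re_part f), l2norm m (re_part f) <= e,
      sqint m (im_part f) & l2norm m (im_part f) <= e].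
Proof.
move=> mf fe; have [rs is_] := sqint_parts mf (lt_trans fe (ltry e)).
have [rle ile] := l2norm_parts_le f.
move: fe; rewrite L2norm_fin// lte_fin => /ltW fe.
by split=> //; [exact: le_trans fe|exact: le_trans fe].
Qed.

Lemma ae_eq0_complex_l2norm f : sqint m (re_part f) -> sqint m (im_part f) ->
  {ae m, forall x, f x = 0} <-> complex_l2norm f = 0.
Proof.
move=> rs is_; split=> [f0|n0].
- have -> : 0 = Num.sqrt (0 + 0) :> R by rewrite addr0 sqrtr0.
  have z (g : T -> R) : measurable_fun setT g -> {ae m, forall x, g x = 0} ->
      \int[m]_x (g x ^+ 2) = 0.
    move=> mg g0; rewrite /Rintegral (ae_eq_integral (cst 0%E))//.
    + by rewrite integral0.
    + by apply/measurable_EFinP; exact: measurable_funX.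
    + by apply: filterS g0 => x gx _; rewrite gx expr0n.
  congr (Num.sqrt (_ + _)); apply: z; [exact: rs.1| |exact: is_.1|].
  + by apply: filterS f0 => x fx; rewrite /re_part fx.
  + by apply: filterS f0 => x fx; rewrite /im_part fx.
- have mn : measurable_fun setT (EFin \o (fun x => normc (f x))).
    apply/measurable_EFinP.
    rewrite (_ : (fun x => normc (f x)) =
      (fun x => Num.sqrt (re_part f x ^+ 2 + im_part f x ^+ 2))).
      apply: (measurableT_comp (continuous_measurable_fun (@sqrt_continuous R))).
      by apply: measurable_funD; apply: measurable_funX; [exact: rs.1|exact: is_.1].
    by apply/funext => x; rewrite /re_part /im_part; case: (f x).
  have N0 : L2norm m f = 0%E by rewrite L2norm_fin// n0.
  have p0 : (0 < 2%:E :> \bar R)%E by rewrite lte_fin.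
  have := Lnorm_eq0_eq0 mn p0 N0; apply: filterS => x /(_ I) [].
  exact: eq0_normc.
Qed.

Lemma l2normZ (a : R) (g : T -> R) : sqint m g ->
  l2norm m (fun x => a * g x) = `|a| * l2norm m g.
Proof.
move=> gs; rewrite /l2norm; under eq_Rintegral do rewrite exprMn.
rewrite RintegralZl//; last exact: gs.2.
by rewrite sqrtrM ?sqr_ge0// sqrtr_sqr.
Qed.

End complex_L2.

(** * Real and imaginary parts of the process data *)

Lemma at_right0_interval (R : realType) (Q : R -> Prop) :
  (\forall t \near 0^'+, Q t) ->
  exists2 dl : R, 0 < dl & forall s, 0 < s -> s < dl -> Q s.
Proof.
move=> [dl /= dl0 H]; exists dl => // s s0 sdl; apply: H => //=.
by rewrite sub0r normrN gtr0_norm.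
Qed.

Lemma cvg0_at_right_lt (R : realType) (phi : R -> \bar R) :
  phi t @[t --> 0^'+] --> 0%E -> forall e : R, 0 < e ->
  exists2 dl : R, 0 < dl & forall s, 0 < s -> s < dl -> (phi s < e%:E)%E.
Proof.
move=> phi0 e e0; apply: at_right0_interval.
have : nbhs (0%E : \bar R) [set y | (y < e%:E)%E].
  exact: (open_nbhs_nbhs (conj (@open_ereal_lt_ereal R e%:E) _)).
by move/phi0.
Qed.

Section complex_process.
Context d d' (S : measurableType d) (Omega : measurableType d') (R : realType).
Variables (mu : probability S R) (Pr : R.-pker S ~> Omega) (X : R -> Omega -> S).
Hypothesis HX : markov_process Pr X.
Hypothesis Hmu : invariant_measure mu Pr X.
Hypothesis HP : strongly_continuous mu Pr X.

Local Notation P := (start_law mu Pr).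
Local Notation I := (@time_integral _ _ S Omega R X).

Lemma cmeasurable_semigroup t (f : S -> R[i]) : 0 <= t -> cmeasurable f ->
  cmeasurable (semigroup Pr X t f).
Proof.
move=> t0 [mr mi]; split.
- exact: (measurable_real_semigroup HX t0 mr).
- exact: (measurable_real_semigroup HX t0 mi).
Qed.

Lemma cmeasurableB (f g : S -> R[i]) : cmeasurable f -> cmeasurable g ->
  cmeasurable (fun x => f x - g x).
Proof.
move=> [fr fi] [gr gi]; split.
- rewrite (_ : (fun x => _) = re_part f \- re_part g); first exact: measurable_funB.
  by apply/funext => x; rewrite /re_part /=; case: (f x) (g x) => a b [].
- rewrite (_ : (fun x => _) = im_part f \- im_part g); first exact: measurable_funB.
  by apply/funext => x; rewrite /im_part /=; case: (f x) (g x) => a b [].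
Qed.

Lemma re_scale (a : R) (z : R[i]) : complex.Re (a%:C * z) = a * complex.Re z.
Proof. by case: z => x y /=; rewrite mul0r subr0. Qed.

Lemma im_scale (a : R) (z : R[i]) : complex.Im (a%:C * z) = a * complex.Im z.
Proof. by case: z => x y /=; rewrite mul0r addr0. Qed.

Lemma cmeasurableZ (a : R) (f : S -> R[i]) : cmeasurable f ->
  cmeasurable (fun x => a%:C * f x).
Proof.
move=> [fr fi]; split.
- by under eq_fun do rewrite re_scale; exact: measurable_funM.
- by under eq_fun do rewrite im_scale; exact: measurable_funM.
Qed.

Lemma right_continuous_orbit_parts (h : S -> R[i]) : L2 mu h ->
  right_continuous_orbit mu Pr X (re_part h) /\
  right_continuous_orbit mu Pr X (im_part h).
Proof.
move=> h2; have lim := cvg0_at_right_lt (HP h2).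
have mF s : 0 < s -> cmeasurable (fun x => semigroup Pr X s h x - h x).
  by move=> s0; apply: cmeasurableB h2.1; apply: cmeasurable_semigroup (ltW s0) h2.1.
have rE s : re_part (fun x => semigroup Pr X s h x - h x) =
    (fun x => real_semigroup Pr X s (re_part h) x - re_part h x).
  by apply/funext => x; rewrite /re_part /=; case: (h x).
have iE s : im_part (fun x => semigroup Pr X s h x - h x) =
    (fun x => real_semigroup Pr X s (im_part h) x - im_part h x).
  by apply/funext => x; rewrite /im_part /=; case: (h x).
split=> e e0; have [dl dl0 H] := lim e e0; exists dl => // s s0 sdl;
  have [] := small_parts (mF s s0) (H s s0 sdl).
- by rewrite rE.
- by rewrite iE.
Qed.

Lemma real_generator_parts (f h : S -> R[i]) : generator mu Pr X f h ->
  real_generator mu Pr X (re_part f) (re_part h) /\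
  real_generator mu Pr X (im_part f) (im_part h).
Proof.
move=> [f2 h2 /cvg0_at_right_lt lim].
pose F s x := (s^-1)%:C * (semigroup Pr X s f x - f x) - h x.
have mF s : 0 < s -> cmeasurable (F s).
  move=> s0; apply: cmeasurableB h2.1; apply: cmeasurableZ.
  by apply: cmeasurableB f2.1; apply: cmeasurable_semigroup (ltW s0) f2.1.
have rE s : 0 < s -> (fun x => real_semigroup Pr X s (re_part f) x -
    (re_part f x + s * re_part h x)) = (fun x => s * re_part (F s) x).
  move=> s0; apply/funext => x; rewrite /re_part /F raddfB/= re_scale raddfB/=.
  by rewrite mulrBr mulrA mulfV ?gt_eqF// mul1r opprD addrA.
have iE s : 0 < s -> (fun x => real_semigroup Pr X s (im_part f) x -
    (im_part f x + s * im_part h x)) = (fun x => s * im_part (F s) x).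
  move=> s0; apply/funext => x; rewrite /im_part /F raddfB/= im_scale raddfB/=.
  by rewrite mulrBr mulrA mulfV ?gt_eqF// mul1r opprD addrA.
split=> e e0; have [dl dl0 H] := lim e e0; exists dl => // s s0 sdl;
  have [rs rle is_ ile] := small_parts (mF s s0) (H s s0 sdl).
- rewrite rE//; split; first exact: sqintZ.
  by rewrite l2normZ// gtr0_norm// mulrC ler_wpM2r// ltW.
- rewrite iE//; split; first exact: sqintZ.
  by rewrite l2normZ// gtr0_norm// mulrC ler_wpM2r// ltW.
Qed.

(** The means of f(X_s) do not depend on s, so that their derivative, the mean
    of h, vanishes: this is the expansion of the correlation with 1. *)
Lemma real_generator_mean0 (f h : S -> R) : sqint mu f -> sqint mu h ->
  real_generator mu Pr X f h -> \int[mu]_x h x = 0.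
Proof.
move=> fs hs fh; apply/eqP; rewrite -normr_le0; apply/ler_addgt0Pr => e e0.
have s1 := sqint_cst mu 1.
have [dl dl0 /(_ (dl / 2) 0)] := correlation_taylor HX Hmu s1 fs hs fh e0.
have dl20 : 0 < dl / 2 by rewrite divr_gt0.
have corr1 (g : S -> R) r : 0 <= r -> sqint mu g ->
    correlation mu Pr X (cst 1) g r = \int[mu]_x g x.
  move=> r0 gs; rewrite -(integral_path HX Hmu r0 gs.1).
  by apply: eq_Rintegral => w _; rewrite mul1r.
rewrite !corr1 ?add0r// ?(ltW dl20)// subrr sub0r normrN normrM (gtr0_norm dl20).
rewrite [e * _]mulrC ler_pM2l//; apply => //; lra.
Qed.

Lemma generator_image_L20 (f h : S -> R[i]) : generator mu Pr X f h -> L20 mu h.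
Proof.
move=> fh; have [rfh ifh] := real_generator_parts fh.
have [f2 h2 _] := fh; split=> //.
have [rfs ifs] := (L2P mu f).1 f2; have [rhs ihs] := (L2P mu h).1 h2.
rewrite /cintegral.
have -> : \int[mu]_x complex.Re (h x) = 0 by exact: real_generator_mean0 rfs rhs rfh.
have -> : \int[mu]_x complex.Im (h x) = 0 by exact: real_generator_mean0 ifs ihs ifh.
by [].
Qed.

Lemma time_average_varE t (g : S -> R[i]) : 0 < t -> L20 mu g ->
  time_average_var mu Pr X t g =
  (t^-1 ^+ 2 * (\int[P]_w (I t (re_part g) w ^+ 2) +
                \int[P]_w (I t (im_part g) w ^+ 2)))%:E.
Proof.
move=> t0 [/L2P[rs is_] g0]; rewrite /time_average_var g0.
have Ir := sqint_time_integral HX Hmu t0 rs.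
have Ii := sqint_time_integral HX Hmu t0 is_.
have iI := integrable_add Ir.2 Ii.2.
rewrite -RintegralD//; [|exact: Ir.2|exact: Ii.2].
rewrite -RintegralZl// /Rintegral fineK; last first.
  exact: (integrable_fin_num measurableT (integrable_scale _ iI)).
apply: eq_integral => w _; rewrite subr0 sqr_normc_parts /time_average.
by rewrite re_scale im_scale !exprMn -mulrDr.
Qed.

End complex_process.

(** * Rescaling to norm one *)

Section scaling.
Context d d' (S : measurableType d) (Omega : measurableType d') (R : realType).
Variables (mu : probability S R) (Pr : R.-pker S ~> Omega) (X : R -> Omega -> S).
Hypothesis HX : markov_process Pr X.
Hypothesis Hmu : invariant_measure mu Pr X.

Local Notation P := (start_law mu Pr).
Local Notation I := (@time_integral _ _ S Omega R X).

(** The time integrals of k g and g are proportional for almost every path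
    only. Pairing each of them with the other through Fubini avoids the
    exceptional set. *)
Lemma integral_sqr_time_integralZ t (k : R) (g : S -> R) :
  0 < t -> sqint mu g ->
  \int[P]_w (I t (fun x => k * g x) w ^+ 2) = k ^+ 2 * \int[P]_w (I t g w ^+ 2).
Proof.
move=> t0 gs; have kgs := sqintZ k gs.
have Ig := sqint_time_integral HX Hmu t0 gs.
have Ikg := sqint_time_integral HX Hmu t0 kgs.
have Zk (Z : Omega -> R) : sqint P Z -> \int[P]_w (Z w * I t (fun x => k * g x) w)
    = k * \int[P]_w (Z w * I t g w).
  move=> Zs; rewrite (integral_mul_time_integral HX Hmu t0 kgs Zs).
  rewrite (integral_mul_time_integral HX Hmu t0 gs Zs) -RintegralZl//; last first.
    exact: (integrable_mul_path HX Hmu t0 gs Zs).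
  apply: eq_Rintegral => s; rewrite inE/= in_itv/= => /andP[s0 _].
  rewrite -RintegralZl//; last exact: sqintM Zs (sqint_path HX Hmu s0 gs).
  by apply: eq_Rintegral => w _; rewrite mulrCA.
under eq_Rintegral do rewrite expr2.
rewrite (Zk _ Ikg); under eq_Rintegral do rewrite mulrC.
by rewrite (Zk _ Ig) mulrA -expr2.
Qed.

(** The equality may fail at points x where f(X_t) is not integrable. *)
Lemma ae_real_semigroupZ t (k : R) (f : S -> R) : 0 <= t -> sqint mu f ->
  {ae mu, forall x, real_semigroup Pr X t (fun y => k * f y) x =
    k * real_semigroup Pr X t f x}.
Proof.
move=> t0 fs.
have := ae_integrable_start_law (sqint_integrable (sqint_path HX Hmu t0 fs)).
by apply: filterS => x fx; rewrite /real_semigroup RintegralZl.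
Qed.

Lemma ae_L2normZ (k : R) (f g : S -> R[i]) : 0 <= k -> cmeasurable f ->
  cmeasurable g ->
  {ae mu, forall x, re_part f x = k * re_part g x} ->
  {ae mu, forall x, im_part f x = k * im_part g x} ->
  L2norm mu f = (k%:E * L2norm mu g)%E.
Proof.
move=> k0 mf mg fgr fgi; rewrite !L2normE.
have -> : k%:E = sqrte (k ^+ 2)%:E by rewrite /= sqrtr_sqr ger0_norm.
rewrite -sqrteM ?lee_fin ?sqr_ge0//; congr sqrte.
rewrite -ge0_integralZl//; first last.
- by rewrite lee_fin sqr_ge0.
- by move=> x _; rewrite lee_fin addr_ge0 ?sqr_ge0.
- exact: measurable_sum_sqr.
apply: ae_eq_integral => //.
- exact: measurable_sum_sqr.
- by apply: measurable_funeM; exact: measurable_sum_sqr.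
apply: filterS2 fgr fgi => x fr fi _.
by rewrite fr fi !exprMn -mulrDr EFinM.
Qed.

Lemma generatorZ (k : R) (f h : S -> R[i]) : 0 <= k ->
  generator mu Pr X f h ->
  generator mu Pr X (fun x => k%:C * f x) (fun x => k%:C * h x).
Proof.
move=> k0 [f2 h2 lim].
have LZ (g : S -> R[i]) : L2 mu g -> L2 mu (fun x => k%:C * g x).
  move=> /L2P[rs is_]; apply/L2P; split.
    rewrite (_ : re_part _ = fun x => k * re_part g x); first exact: sqintZ.
    by apply/funext => x; rewrite /re_part re_scale.
  rewrite (_ : im_part _ = fun x => k * im_part g x); first exact: sqintZ.
  by apply/funext => x; rewrite /im_part im_scale.
have kf2 := LZ f f2; have kh2 := LZ h h2; split => //.
have [rs is_] := (L2P mu f).1 f2.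
rewrite -(mule0 k%:E); apply: cvg_trans (cvgeZl _ lim) => //.
apply: near_eq_cvg; near=> t.
have t0 : 0 < t by near: t; exact: nbhs_right_gt.
have mF (u v : S -> R[i]) : cmeasurable u -> cmeasurable v ->
    cmeasurable (fun x => (t^-1)%:C * (semigroup Pr X t u x - u x) - v x).
  move=> um vm; apply: cmeasurableB vm; apply: cmeasurableZ.
  by apply: (cmeasurableB _ um); exact: (cmeasurable_semigroup HX (ltW t0) um).
apply: esym; apply: (ae_L2normZ k0).
- exact: mF kf2.1 kh2.1.
- exact: mF f2.1 h2.1.
- apply: filterS (ae_real_semigroupZ k (ltW t0) rs) => x fx.
  rewrite /re_part raddfB/= re_scale raddfB/= !re_scale.
  rewrite [in RHS]raddfB/= re_scale [in RHS]raddfB/=.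
  rewrite [X in _ * (X - _)](_ : _ = k * real_semigroup Pr X t (re_part f) x).
    by rewrite /real_semigroup /re_part; ring.
  rewrite -fx; apply: eq_Rintegral => w _; exact: re_scale.
- apply: filterS (ae_real_semigroupZ k (ltW t0) is_) => x fx.
  rewrite /im_part raddfB/= im_scale raddfB/= !im_scale.
  rewrite [in RHS]raddfB/= im_scale [in RHS]raddfB/=.
  rewrite [X in _ * (X - _)](_ : _ = k * real_semigroup Pr X t (im_part f) x).
    by rewrite /real_semigroup /im_part; ring.
  rewrite -fx; apply: eq_Rintegral => w _; exact: im_scale.
Unshelve. all: by end_near. Qed.

(** [Delta] tests functions of norm 1 only; this is the homogeneous form of the
    bound. *)
Lemma Delta_bound (W : set (S -> R[i])) (g : S -> R[i]) (s D : R) :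
  L2 mu g -> 0 < complex_l2norm mu g -> 0 < s ->
  let g1 := fun x => ((complex_l2norm mu g)^-1)%:C * g x in
  W g1 -> L20 mu g1 -> (Delta mu Pr X W s <= D%:E)%E ->
  Num.sqrt (\int[P]_w (I s (re_part g) w ^+ 2) +
            \int[P]_w (I s (im_part g) w ^+ 2)) <= s * (D * complex_l2norm mu g).
Proof.
move=> /L2P[rs is_] n0 s0; set n := complex_l2norm mu g in n0 *; set k := n^-1.
move=> g1 Wg g10 DD; have k0 : 0 < k by rewrite invr_gt0.
have rE : re_part g1 = fun x => k * re_part g x.
  by apply/funext => x; rewrite /re_part re_scale.
have iE : im_part g1 = fun x => k * im_part g x.
  by apply/funext => x; rewrite /im_part im_scale.
have n1 : L2norm mu g1 = 1%E.
  rewrite L2norm_fin ?rE ?iE; [|exact: sqintZ..].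
  rewrite /complex_l2norm rE iE.
  under [X in X + _]eq_Rintegral do rewrite exprMn.
  under [X in _ + X]eq_Rintegral do rewrite exprMn.
  rewrite !RintegralZl//; [|exact: is_.2|exact: rs.2].
  rewrite -mulrDr sqrtrM ?sqr_ge0// sqrtr_sqr gtr0_norm//.
  by rewrite -/(complex_l2norm mu g) -/n mulVf// gt_eqF.
have : (sqrte (time_average_var mu Pr X s g1) <= D%:E)%E.
  by apply: le_trans DD; apply: ereal_sup_ubound; right; exists g1.
rewrite (time_average_varE HX Hmu s0 g10) rE iE !integral_sqr_time_integralZ//.
rewrite -mulrDr /= lee_fin sqrtrM ?sqr_ge0// sqrtr_sqr sqrtrM ?sqr_ge0// sqrtr_sqr.
rewrite (gtr0_norm k0) gtr0_norm ?invr_gt0// /k mulrCA ler_pdivrMl//.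
rewrite ler_pdivrMl// => /le_trans; apply.
by rewrite le_eqVlt; apply/orP; left; apply/eqP; ring.
Qed.

End scaling.

(** * The theorem *)

Lemma cauchy_schwarz_R2 (R : realType) (a b c d : R) :
  0 <= a -> 0 <= b -> 0 <= c -> 0 <= d ->
  Num.sqrt a * Num.sqrt b + Num.sqrt c * Num.sqrt d <=
  Num.sqrt (a + c) * Num.sqrt (b + d).
Proof.
move=> a0 b0 c0 d0.
rewrite -{2}(sqr_sqrtr a0) -{2}(sqr_sqrtr b0) -{2}(sqr_sqrtr c0) -{2}(sqr_sqrtr d0).
move: (Num.sqrt a) (Num.sqrt b) (Num.sqrt c) (Num.sqrt d) => {a0 b0 c0 d0}x y z w.
rewrite -sqrtrM ?addr_ge0 ?sqr_ge0//; apply: le_trans (ler_norm _) _.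
rewrite -sqrtr_sqr ler_wsqrtr//.
rewrite -subr_ge0 (_ : _ - _ = (x * w - z * y) ^+ 2) ?sqr_ge0//; ring.
Qed.

Section theorem.
Context d d' (S : measurableType d) (Omega : measurableType d') (R : realType).
Variables (mu : probability S R) (Pr : R.-pker S ~> Omega) (X : R -> Omega -> S).
Hypothesis HX : markov_process Pr X.
Hypothesis Hmu : invariant_measure mu Pr X.
Hypothesis HP : strongly_continuous mu Pr X.
Variable V : set (S -> R[i]).
Hypotheses (HV : linear_subspace mu V) (HV0 : V `<=` L20 mu).

Local Notation nrm := (complex_l2norm mu).
Local Notation U := (generator_image mu Pr X V).
Local Notation gV := (gamma mu Pr X V).

(** The bounds for both parts are added, and the products of the norms of the
    parts are collected by Cauchy-Schwarz. *)
Lemma generator_variance (f h : S -> R[i]) t : 0 < t ->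
  generator mu Pr X f h ->
  (time_average_var mu Pr X t h <= (4 / t * (nrm h * nrm f))%:E)%E.
Proof.
move=> t0 fh; have [f2 h2 _] := fh.
have [frs fis] := (L2P mu f).1 f2; have [hrs his] := (L2P mu h).1 h2.
have [gr gi] := real_generator_parts HX fh.
have [hcr hci] := right_continuous_orbit_parts HX HP h2.
rewrite (time_average_varE HX Hmu t0 (generator_image_L20 HX Hmu fh)) lee_fin.
have := time_integral_variance HX Hmu frs hrs gr hcr t0.
have := time_integral_variance HX Hmu fis his gi hci t0.
have sq0 (g : S -> R) : 0 <= \int[mu]_x (g x ^+ 2).
  by rewrite Rintegral_ge0// => x _; rewrite sqr_ge0.
have := cauchy_schwarz_R2 (sq0 (re_part h)) (sq0 (re_part f))
  (sq0 (im_part h)) (sq0 (im_part f)).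
rewrite -!/(l2norm _ _) -!/(complex_l2norm _ _) => cs vi vr.
rewrite exprVn ler_pdivrMl ?exprn_gt0//.
rewrite (_ : t ^+ 2 * _ = 4 * t * (nrm h * nrm f)); last by field; rewrite gt_eqF.
have := ler_wpM2l (_ : 0 <= 4 * t) cs; rewrite mulrDr => /(_ _).
have t40 : 0 <= 4 * t by lra.
move=> /(_ t40); lra.
Qed.

Lemma gamma_le (f h : S -> R[i]) : V f -> generator mu Pr X f h ->
  0 < nrm f -> (gV <= (nrm h / nrm f)%:E)%E.
Proof.
move=> Vf fh nf0; have [f2 h2 _] := fh.
have [frs fis] := (L2P mu f).1 f2; have [hrs his] := (L2P mu h).1 h2.
apply: ereal_inf_lbound; exists f, h; split=> //.
  by move/(ae_eq0_complex_l2norm frs fis) => nf; rewrite nf ltxx in nf0.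
by rewrite !L2norm_fin// inver gt_eqF.
Qed.

Lemma Delta_ge0 (W : set (S -> R[i])) t : (0 <= Delta mu Pr X W t)%E.
Proof. by apply: ereal_sup_ubound; left. Qed.

Lemma Delta_generator_image t : 0 < t -> (0 < gV)%E ->
  (Delta mu Pr X U t <= 2%:E / sqrte (t%:E * gV))%E.
Proof.
move=> t0 g0; have rhs0 : (0 <= 2%:E / sqrte (t%:E * gV))%E.
  by rewrite mule_ge0 ?inve_ge0 ?sqrte_ge0// lee_fin.
apply: ge_ereal_sup => _ [->//|[h [[f Vf fh] h1]] <-].
have [f2 h2 _] := fh.
have [hrs his] := (L2P mu h).1 h2.
have nh1 : nrm h = 1.
  by move: h1; rewrite L2norm_fin// => -[].
have var := generator_variance t0 fh; rewrite nh1 mul1r in var.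
have nf0 : 0 <= nrm f by exact: sqrtr_ge0.
have [nf|nfN] := eqVneq (nrm f) 0.
  apply: le_trans rhs0; rewrite -sqrte0 lee_sqrt//.
  by apply: le_trans var _; rewrite nf mulr0.
have nfp : 0 < nrm f by rewrite lt_neqAle eq_sym nfN.
have := gamma_le Vf fh nfp; rewrite nh1 mul1r.
move: g0; case: gV => [g| |] //.
rewrite lte_fin lee_fin => g0 gle.
have tg0 : 0 < t * g by rewrite mulr_gt0.
have stg0 : 0 < Num.sqrt (t * g) by rewrite sqrtr_gt0.
rewrite [(_ / _)%E](_ : _ = (2 / Num.sqrt (t * g))%:E); last first.
  by rewrite -EFinM /= inver gt_eqF.
have -> : (2 / Num.sqrt (t * g))%:E = sqrte (4 / (t * g))%:E.
  congr EFin; rewrite [RHS]sqrtrM// sqrtrV ?(ltW tg0)//; congr (_ / _).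
  by rewrite (_ : 4 = 2 ^+ 2) ?sqrtr_sqr ?ger0_norm//; ring.
have r40 : 0 <= 4 / (t * g) by rewrite divr_ge0// ltW.
rewrite lee_sqrt ?lee_fin//; apply: le_trans var _; rewrite lee_fin.
rewrite invfM mulrA ler_wpM2l ?divr_ge0 ?(ltW t0)//.
by rewrite -[leLHS]invrK lef_pV2 ?posrE ?invr_gt0.
Qed.

(** Both f and Lf belong to U + V, so that D controls both time integrals in
    [relaxation_lower_bound]. *)
Lemma relaxation_sup (f h : S -> R[i]) (t D : R) : 0 < t ->
  V f -> generator mu Pr X f h -> 0 < nrm f -> 0 < nrm h ->
  (forall s, t <= s -> s <= 2 * t -> (Delta mu Pr X (sumset U V) s <= D%:E)%E) ->
  1 <= D * (3 / 2 * t * (nrm h / nrm f) + 3).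
Proof.
move=> t0 Vf fh nf0 nh0 HD.
have [f2 h2 _] := fh.
have [frs fis] := (L2P mu f).1 f2; have [hrs his] := (L2P mu h).1 h2.
have [gr gi] := real_generator_parts HX fh.
have [hcr hci] := right_continuous_orbit_parts HX HP h2.
have VZ (c : R) (g : S -> R[i]) : V g -> V (fun x => c%:C * g x).
  move=> Vg; have := lsub_lin HV c%:C Vg (lsub_0 HV).
  by under eq_fun do rewrite addr0.
have UV (g : S -> R[i]) : U g -> sumset U V g.
  move=> Ug; exists g => //; exists (fun=> 0); first exact: lsub_0 HV.
  by apply/funext => x; rewrite addr0.
have U0 : U (fun=> 0).
  have := generatorZ HX Hmu (lexx 0) fh => fh0.
  exists (fun x => 0%:C * f x); first exact: VZ.
  by move: fh0; under [X in generator _ _ _ _ X]eq_fun do rewrite mul0r.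
have VV (g : S -> R[i]) : V g -> sumset U V g.
  move=> Vg; exists (fun=> 0) => //; exists g => //.
  by apply/funext => x; rewrite add0r.
have hbound s : t <= s -> s <= 2 * t ->
    Num.sqrt (\int[start_law mu Pr]_w (time_integral X s (re_part h) w ^+ 2) +
      \int[start_law mu Pr]_w (time_integral X s (im_part h) w ^+ 2)) <=
    s * (D * nrm h).
  move=> ts st; have s0 : 0 < s by lra.
  have knn : 0 <= (nrm h)^-1 by rewrite invr_ge0 ltW.
  have kfh := generatorZ HX Hmu knn fh.
  apply: (Delta_bound HX Hmu h2 nh0 s0 _ _ (HD s ts st)).
    by apply: UV; exists (fun x => ((nrm h)^-1)%:C * f x) => //; exact: VZ.
  exact: generator_image_L20 kfh.
have fbound s : t <= s -> s <= 2 * t ->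
    Num.sqrt (\int[start_law mu Pr]_w (time_integral X s (re_part f) w ^+ 2) +
      \int[start_law mu Pr]_w (time_integral X s (im_part f) w ^+ 2)) <=
    s * (D * nrm f).
  move=> ts st; have s0 : 0 < s by lra.
  have Vkf := VZ (nrm f)^-1 f Vf.
  apply: (Delta_bound HX Hmu f2 nf0 s0 _ _ (HD s ts st)); first exact: VV.
  exact: HV0.
have := relaxation_lower_bound HX Hmu frs fis hrs his gr gi hcr hci t0 hbound fbound.
rewrite -/(complex_l2norm mu f) => H.
have tn0 : 0 < t * nrm f by rewrite mulr_gt0.
rewrite -(ler_pM2l tn0) mulr1; apply: le_trans H _.
rewrite le_eqVlt; apply/orP; left; apply/eqP; field; exact: lt0r_neq0.
Qed.

(** [relaxation_sup] bounds every quotient |Lf| / |f| from below by an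
    expression in the supremum D, hence also their infimum gamma. *)
Lemma sup_Delta_sumset t : 0 < t -> (0 < gV)%E ->
  (((3 / 2)%:E * t%:E * gV + 3%:E)^-1 <=
    ereal_sup [set Delta mu Pr X (sumset U V) s | s in `[t, (2 * t)%R]])%E.
Proof.
move=> t0 g0; set sD := ereal_sup _.
have DsD s : t <= s -> s <= 2 * t -> (Delta mu Pr X (sumset U V) s <= sD)%E.
  by move=> ts st; apply: ereal_sup_ubound; exists s; rewrite //= in_itv/= ts.
have sD0 : (0 <= sD)%E.
  by apply: le_trans (DsD t (lexx t) _); [exact: Delta_ge0|lra].
have c0 : 0 < 3 / 2 * t by rewrite mulr_gt0.
move: g0; case gE : gV => [g| |] // g0; last first.
  by rewrite -EFinM gt0_muley ?lte_fin.
move: DsD sD0; case: sD => [D| |] // DsD sD0; last by rewrite leey.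
rewrite lte_fin in g0; rewrite lee_fin in sD0.
have cg0 : 0 < 3 / 2 * t * g + 3 by rewrite addr_gt0// mulr_gt0.
rewrite -!EFinM -EFinD inver gt_eqF// lee_fin.
have ratio (f h : S -> R[i]) : V f -> generator mu Pr X f h ->
    ~ {ae mu, forall x, f x = 0} -> 
    [/\ L2norm mu h = (nrm h)%:E, L2norm mu f = (nrm f)%:E & 0 < nrm f].
  move=> Vf fh fN; have [f2 h2 _] := fh.
  have [frs fis] := (L2P mu f).1 f2; have [hrs his] := (L2P mu h).1 h2.
  rewrite !L2norm_fin//; split=> //.
  rewrite lt_neqAle eq_sym sqrtr_ge0 andbT; apply/negP => /eqP nf.
  by apply: fN; apply/(ae_eq0_complex_l2norm frs fis).
have main (f h : S -> R[i]) : V f -> generator mu Pr X f h ->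
    ~ {ae mu, forall x, f x = 0} -> 1 <= D * (3 / 2 * t * (nrm h / nrm f) + 3).
  move=> Vf fh fN; have [_ _ nf0] := ratio f h Vf fh fN.
  apply: relaxation_sup => //.
  have := gamma_le Vf fh nf0; rewrite gE lee_fin => gle.
  have : 0 < nrm h / nrm f by exact: lt_le_trans gle.
  by rewrite pmulr_lgt0// invr_gt0.
(* gamma is finite, so that some quotient is available to rule out D = 0 *)
have D0 : 0 < D.
  rewrite lt_neqAle eq_sym sD0 andbT; apply/negP => /eqP D0.
  have : (+oo <= gV)%E.
    apply: le_ereal_inf_tmp => r [f [h [Vf fh fN _]]].
    by have := main f h Vf fh fN; rewrite D0 mul0r ler10.
  by rewrite gE.
rewrite invf_ple ?posrE//.
suff : (((D^-1 - 3) / (3 / 2 * t))%:E <= gV)%E.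
  by rewrite gE lee_fin ler_pdivrMr// => H; lra.
apply: le_ereal_inf_tmp => r [f [h [Vf fh fN ->]]].
have [-> -> nf0] := ratio f h Vf fh fN.
rewrite inver gt_eqF// lee_fin ler_pdivrMr//.
have := main f h Vf fh fN; rewrite -(ler_pdivrMl _ _ D0) mulr1; lra.
Qed.

End theorem.

Unset Implicit Arguments.
Set Strict Implicit.
Set Printing Implicit Defensive.

Theorem theorem1 (R : realType) (d d' : measure_display)
  (S : measurableType d) (Omega : measurableType d')
  (mu : probability S R) (Pr : R.-pker S ~> Omega) (X : R -> Omega -> S)
  (HX : markov_process Pr X) (Hmu : invariant_measure mu Pr X)
  (HP : strongly_continuous mu Pr X)
  (V : set (S -> R[i])) (HV : linear_subspace mu V) (HV0 : V `<=` L20 mu)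
  (Hgamma : (0 < gamma mu Pr X V)%E) :
  let gV := gamma mu Pr X V in
  let U := generator_image mu Pr X V in
  U `<=` L20 mu /\
  forall t : R, 0 < t ->
    (Delta mu Pr X U t <= 2%:E / sqrte (t%:E * gV))%E /\
    (((3 / 2)%:E * t%:E * gV + 3%:E)^-1 <=
       ereal_sup [set Delta mu Pr X (sumset U V) s | s in `[t, (2 * t)%R]])%E.
Proof.
move=> gV U; split.
  by move=> h [f _ fh]; exact: (generator_image_L20 HX Hmu fh).
move=> t t0; split.
- exact: Delta_generator_image.
- exact: sup_Delta_sumset.
Qed.
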